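(* Consider the generalized Pólya urn with $A\ge2$ agents constructed via the exponential embedding. Suppose the set $M=\{i\in[A]:\sum_{k=1}^\infty1/F_i(k)<\infty\}$ is non-empty but $1\notin M$. Assume moreover $\lim_{k\to\infty}F_1(k)=\infty$ and that $F_i$ is strictly monotone for every $i\in M$. Then $$-\log\mathbb{P}(X_1(\infty)>x)\sim d\sum_{k=X_1(0)}^x\frac{1}{F_1(k)}\quad\text{as }x\to\infty,\qquad\text{where } d=\sum_{i\in M}F_i(X_i(0)).$$
   Context: $\mathbb{N}=\{1,2,\dots\}$, $[A]=\{1,\dots,A\}$, $e^{(i)}$ the $i$-th unit vector. For $i\in[A]$, $F_i\colon\mathbb{N}\to(0,\infty)$ and $X_i(0)\in\mathbb{N}$. Let $\Xi_1,\dots,\Xi_A$ be independent pure birth processes: $\Xi_i$ has independent sojourn times $\tau_i(k)$, $k\ge X_i(0)$, exponential with rate $F_i(k)$, and $\Xi_i(t)=\min\{k:\sum_{l=X_i(0)}^k\tau_i(l)>t\}$ (min of empty set $=\infty$). With $\Xi=(\Xi_1,\dots,\Xi_A)$, $t_0=0$, $t_{n+1}=\inf\{t>t_n:\Xi(t)\ne\Xi(t_n)\}$, the urn is $X(n)=\Xi(t_n)$, a Markov chain with $\mathbb{P}(X(n+1)-X(n)=e^{(i)}\mid X(n))=F_i(X_i(n))/\sum_jF_j(X_j(n))$; $X_1(\infty)=\lim_nX_1(n)$. $f\sim h$ means $f/h\to1$. *)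

(* Defs.v *)
From HB Require Import structures.
From mathcomp Require Import all_boot all_order all_algebra.
From mathcomp Require Import finmap.
From mathcomp Require Import all_classical all_reals all_analysis.
From mathcomp Require Import exponential_distribution.
Set Implicit Arguments. Unset Strict Implicit. Unset Printing Implicit Defensive.
Import Order.TTheory GRing.Theory Num.Theory.
Import numFieldNormedType.Exports.
Local Open Scope classical_set_scope.
Local Open Scope ring_scope.

Definition mutually_independent {R : realType} {d : measure_display}
  {T : measurableType d} (P : probability T R) {I : choiceType}
  (S : set I) (X : I -> T -> R) : Prop :=
  forall (J : {fset I}), [set` J] `<=` S ->
  forall B : I -> set R, (forall j, measurable (B j)) ->
  P (\bigcap_(j in [set` J]) (X j @^-1` B j)) =
  (\prod_(j <- J) P (X j @^-1` B j))%E.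

Section urn.
Context {R : realType} {T : Type}.
(* Agents are i = 1..A (as natural numbers); X0 i = X_i(0);
   tau i k w = tau_i(k) evaluated at the outcome w. *)
Variables (A : nat) (X0 : nat -> nat) (tau : nat -> nat -> T -> R).

Definition psum (i k : nat) (w : T) : R :=
  \sum_(X0 i <= l < k.+1) tau i l w.

(* Xi_i(t) = min { k >= X_i(0) : psum i k > t }, min of empty = +oo;
   times are taken in the extended reals so that Xi_i(+oo) = +oo. *)
Definition Xi (i : nat) (t : \bar R) (w : T) : \bar R :=
  ereal_inf [set ((k%:R)%:E : \bar R) | k in
              [set k : nat | (X0 i <= k)%N /\ (t < (psum i k w)%:E)%E]].

Fixpoint jump_time (n : nat) (w : T) : \bar R :=
  match n with
  | 0 => 0%E
  | n'.+1 => ereal_inf [set (t%:E : \bar R) | t in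
              [set t : R | (jump_time n' w < t%:E)%E /\
                 exists i, [/\ (1 <= i)%N, (i <= A)%N &
                    Xi i t%:E w <> Xi i (jump_time n' w) w]]]
  end.

Definition urn (i n : nat) (w : T) : \bar R := Xi i (jump_time n w) w.

Definition urn_lim (i : nat) (w : T) : \bar R := limn (fun n => urn i n w).
End urn.

Definition asymp_equiv {R : realType} (f h : nat -> R) : Prop :=
  (fun x => f x / h x) @ \oo --> (1 : R).

(* Main.v *)
(* Write [S] for the time at which agent 1 leaves state [x] and [T_i] for the
   explosion time of agent [i].  Almost surely, [X_1] exceeds [x] in the limit
   iff [S < T_i] for every other agent [i]; agents outside [M] never explode.

   Upper bound: the rates of an agent in [M] are increasing, so [T_i] has
   exponential moments of every order [theta_i < F_i(X_i(0))]; Markov's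
   inequality for [expR (\sum_i theta_i (T_i - S))] and independence bound the
   probability by a constant times [\prod_k F_1(k) / (F_1(k) + \sum_i theta_i)].

   Lower bound: it suffices that [S <= c] while the first sojourn of each agent
   in [M] exceeds [c]; for [c] slightly larger than [\sum_k 1 / F_1(k)] an
   exponential Markov inequality shows that [S <= c] has probability at least
   one half, and the sojourns contribute [expR (- d c)].

   Since [F_1] tends to infinity, [ln (1 + a / F_1(k))] and [a / F_1(k)] are
   equivalent, and both bounds have the announced logarithm. *)

Require Import Defs.
From HB Require Import structures.
From mathcomp Require Import all_boot all_order all_algebra.
From mathcomp Require Import finmap.
From mathcomp Require Import all_classical all_reals all_analysis.
From mathcomp Require Import measurable_realfun.
From mathcomp Require Import exponential_distribution.
From mathcomp Require Import ring lra.
Import Order.TTheory GRing.Theory Num.Theory.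
Import numFieldNormedType.Exports HBNNSimple.
Set Implicit Arguments.
Unset Strict Implicit.
Unset Printing Implicit Defensive.
Local Open Scope classical_set_scope.
Local Open Scope ring_scope.

(** * Independence and exponential laws *)

Section comp_eq.
Context d1 d2 (T1 : measurableType d1) (T2 : measurableType d2) (R : realType).
Variables (m1 : {measure set T1 -> \bar R}) (m2 : {measure set T2 -> \bar R}).
Variables (X1 : T1 -> R) (X2 : T2 -> R) (g1 : T1 -> R) (g2 : T2 -> R).
Hypotheses (mX1 : measurable_fun setT X1) (mX2 : measurable_fun setT X2).
Hypotheses (mg1 : measurable_fun setT g1) (mg2 : measurable_fun setT g2).
Hypotheses (g1_ge0 : forall x, 0 <= g1 x) (g2_ge0 : forall x, 0 <= g2 x).

(** The weight [g] is what lets one comparison lemma serve twice: as a density against Lebesgue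
    measure, and as the product of the remaining factors under independence. *)
Let wint d (T : measurableType d) (m : {measure set T -> \bar R})
  (X g : T -> R) (f : R -> R) := (\int[m]_x (f (X x) * g x)%:E)%E.

Let wint_simple d (T : measurableType d) (m : {measure set T -> \bar R})
  (X g : T -> R) (h : {nnsfun R >-> R}) :
  measurable_fun setT X -> measurable_fun setT g -> (forall x, 0 <= g x) ->
  wint m X g h =
  (\sum_(y <- fset_set (range h)) (y%:E * wint m X g (\1_(h @^-1` [set y]))))%E.
Proof.
move=> mX mg g0; rewrite /wint.
have rh y : y \in fset_set (range h) -> 0 <= y.
  by rewrite in_fset_set // => /set_mem [x _ <-].
have mi y : measurable_fun setT (fun x => \1_(h @^-1` [set y]) (X x) * g x : R).
  apply: measurable_funM => //; apply: (measurableT_comp _ mX).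
  by apply: measurable_indic.
(* Integrating a nonnegative sum termwise asks for nonnegative summands at every index [y], even
   outside the range of [h]; [Num.max 0 y] provides this and equals [y] on the range. *)
transitivity (\int[m]_x (\sum_(y <- fset_set (range h))
    ((Num.max 0 y)%:E * (\1_(h @^-1` [set y]) (X x) * g x)%:E)))%E.
  apply: eq_integral => x _; rewrite [in LHS]fimfunE fsbig_finite //= mulr_suml.
  rewrite -sumEFin; apply: eq_big_seq => y /rh y0.
  by rewrite (max_r y0) -EFinM mulrA.
rewrite ge0_integral_sum //; last first.
- by move=> y x _; rewrite -EFinM lee_fin !mulr_ge0 // le_max lexx.
- by move=> y; apply/measurable_EFinP => //; apply: measurable_funM.
apply: eq_big_seq => y /rh y0; rewrite (max_r y0) ge0_integralZl_EFin //.
- by move=> x _; rewrite lee_fin mulr_ge0.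
- exact/measurable_EFinP.
Qed.

(** Agreement on indicators extends to simple functions by linearity and to nonnegative measurable
    [f] by monotone convergence along [nnsfun_approx]. *)
Lemma ge0_integral_comp_eq :
  (forall B, measurable B -> wint m1 X1 g1 \1_B = wint m2 X2 g2 \1_B) ->
  forall f : R -> R, measurable_fun setT f -> (forall x, 0 <= f x) ->
  (\int[m1]_x (f (X1 x) * g1 x)%:E = \int[m2]_x (f (X2 x) * g2 x)%:E)%E.
Proof.
move=> H f mf f0.
have mF : measurable_fun setT (EFin \o f) by exact/measurable_EFinP.
pose h := nnsfun_approx measurableT mF.
have lim d (T : measurableType d) (m : {measure set T -> \bar R})
      (X g : T -> R) :
    measurable_fun setT X -> measurable_fun setT g -> (forall x, 0 <= g x) ->
    wint m X g (h n) @[n --> \oo] --> wint m X g f.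
  move=> mX mg g0; rewrite /wint.
  have -> : (\int[m]_x (f (X x) * g x)%:E =
      \int[m]_x limn (fun n => (h n (X x) * g x)%:E))%E.
    apply: eq_integral => x _; apply/esym/cvg_lim => //.
    have : EFin \o (h^~ (X x)) @ \oo --> (f (X x))%:E.
      by apply: (cvg_nnsfun_approx measurableT mF) => // y _; rewrite lee_fin.
    move=> /fine_cvgP [_ hc]; apply/fine_cvgP; split; first exact: nearW.
    by apply: (@cvgM _ _ _ _ (fun n => h n (X x)) (fun=> g x)) => //; exact: cvg_cst.
  apply: cvg_monotone_convergence => //.
  - move=> n; apply/measurable_EFinP; apply: measurable_funM => //.
    exact: (measurableT_comp _ mX).
  - by move=> n x _; rewrite lee_fin mulr_ge0.
  - move=> x _ n k nk; rewrite lee_fin ler_wpM2r //.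
    by have /lefP := nd_nnsfun_approx measurableT mF nk; apply.
have E : (fun n => wint m1 X1 g1 (h n)) = (fun n => wint m2 X2 g2 (h n)).
  apply/funext => n; rewrite !wint_simple //.
  by apply: eq_bigr => y _; rewrite H.
have L1 := lim _ _ m1 _ _ mX1 mg1 g1_ge0.
rewrite E in L1.
exact: (cvg_unique _ L1 (lim _ _ m2 _ _ mX2 mg2 g2_ge0)).
Qed.
End comp_eq.

(** * Expectations of products of independent variables *)

Section independence.
Context {R : realType} {d : measure_display} {T : measurableType d}.
Variables (P : probability T R) (I : choiceType) (S : set I) (X : I -> T -> R).
Hypothesis indep : mutually_independent P S X.
Hypothesis mX : forall j, S j -> measurable_fun setT (X j).

Let integral_preimage (j : I) (B : set R) : S j -> measurable B ->
  (\int[P]_w (\1_B (X j w))%:E = P (X j @^-1` B))%E.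
Proof.
move=> Sj mB; have mXB : measurable (X j @^-1` B).
  by rewrite -[A in measurable A]setTI; exact: mX.
by rewrite -[A in P A]setIT -integral_indic.
Qed.

(** A product of indicators is the indicator of an intersection, so here the definition of
    independence applies directly. *)
Let expectation_prod_indic (s : seq I) (B : I -> set R) (r : I -> R) :
  uniq s -> (forall j, j \in s -> S j) -> (forall j, measurable (B j)) ->
  (forall j, j \in s -> \int[P]_w (\1_(B j) (X j w))%:E = (r j)%:E)%E ->
  (\int[P]_w (\prod_(j <- s) \1_(B j) (X j w))%:E = (\prod_(j <- s) r j)%:E)%E.
Proof.
move=> us sS mB hr; pose J := [fset x in s]%fset.
have Js : perm_eq J s.
  by apply: uniq_perm => // x; rewrite inE.
have JS : [set` J] `<=` S by move=> j; rewrite /= inE => /sS.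
have mcap : measurable (\bigcap_(j in [set` J]) (X j @^-1` B j)).
  apply: fin_bigcap_measurable => //.
  by move=> j /JS Sj; rewrite -[A in measurable A]setTI; exact: mX.
transitivity (\int[P]_w (\1_(\bigcap_(j in [set` J]) (X j @^-1` B j)) w)%:E)%E.
  apply: eq_integral => w _; congr EFin; rewrite -(perm_big _ Js) /=.
  rewrite indicE; case: (pselect ((\bigcap_(j in [set` J]) (X j @^-1` B j)) w)).
    move=> h; rewrite mem_set // big_seq big1 // => j jJ.
    by rewrite indicE mem_set //; exact: h.
  move=> h; rewrite memNset //.
  have /existsNP [j /not_implyP [jJ nB]] := h.
  rewrite (perm_big _ (perm_to_rem jJ)) big_cons /=.
  by rewrite indicE memNset // mul0r.
rewrite integral_indic // setIT.
apply: (etrans (indep JS mB)); rewrite (perm_big _ Js) /= -prodEFin.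
by apply: eq_big_seq => j js; rewrite -hr // integral_preimage //; exact: sS.
Qed.

(** Indicators are upgraded to general nonnegative functions one coordinate at a time. *)
Lemma expectation_prod (s : seq I) (f : I -> R -> R) (r : I -> R) :
  uniq s -> (forall j, j \in s -> S j) ->
  (forall j, measurable_fun setT (f j)) -> (forall j x, 0 <= f j x) ->
  (forall j, j \in s -> \int[P]_w (f j (X j w))%:E = (r j)%:E)%E ->
  (\int[P]_w (\prod_(j <- s) f j (X j w))%:E = (\prod_(j <- s) r j)%:E)%E.
Proof.
move=> us sS.
(* [g] collects the indices at which [f] is not yet known to be an indicator. *)
suff H (g : seq I) : forall (f : I -> R -> R) (r : I -> R),
    (forall j, measurable_fun setT (f j)) -> (forall j x, 0 <= f j x) ->
    (forall j, j \in s -> \int[P]_w (f j (X j w))%:E = (r j)%:E)%E ->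
    (forall j, j \in s -> j \notin g ->
       exists B : set R, measurable B /\ f j = \1_B) ->
    (\int[P]_w (\prod_(j <- s) f j (X j w))%:E = (\prod_(j <- s) r j)%:E)%E.
  by move=> mf f0 hr; apply: (H s) => // j ->.
elim: g => [|a g IH] {}f {}r mf f0 hr fB.
  have /choice [B hB] : forall j, exists B : set R,
      measurable B /\ (j \in s -> f j = \1_B).
    move=> j; have [js|js] := boolP (j \in s).
      by have [B [mB fjB]] := fB j js isT; exists B.
    by exists set0; split.
  rewrite -(expectation_prod_indic us sS (fun j => (hB j).1)).
    apply: eq_integral => w _; congr EFin; apply: eq_big_seq => j js.
    by rewrite ((hB j).2 js).
  by move=> j js; rewrite -((hB j).2 js) hr.
have [as_|ans] := boolP (a \in s); last first.
  apply: IH => // j js jg; apply: fB => //; rewrite inE negb_or jg andbT.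
  by apply: contraNneq ans => <-.
have Sa := sS _ as_.
have pm := perm_to_rem as_.
have remE j : j \in rem a s -> j != a /\ j \in s.
  by rewrite mem_rem_uniq // inE /= => /andP[].
have r0 j : j \in s -> 0 <= r j.
  move=> js; rewrite -lee_fin -hr //; apply: integral_ge0 => w _.
  by rewrite lee_fin.
pose Y w := \prod_(j <- rem a s) f j (X j w).
pose c := \prod_(j <- rem a s) r j.
have Y0 w : 0 <= Y w by apply: prodr_ge0.
have c0 : 0 <= c by rewrite /c big_seq prodr_ge0 // => j /remE [_]; exact: r0.
have mY : measurable_fun setT Y.
  apply: measurable_prod => j /remE [_ js].
  exact: (measurableT_comp (mf j) (mX (sS _ js))).
have cst_mul (h : R -> R) q : measurable_fun setT h -> (forall x, 0 <= h x) ->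
    (\int[P]_w (h (X a w))%:E = q%:E)%E ->
    (\int[P]_w (h (X a w) * c)%:E = (q * c)%:E)%E.
  move=> mh h0 hq; under eq_integral do rewrite mulrC EFinM.
  rewrite ge0_integralZl_EFin // ?hq 1?mulrC //.
  - by move=> w _; rewrite lee_fin.
  - by apply/measurable_EFinP; exact: (measurableT_comp mh (mX Sa)).
transitivity (\int[P]_w (f a (X a w) * Y w)%:E)%E.
  by apply: eq_integral => w _; rewrite (perm_big _ pm) big_cons.
(* The other factors form the weight [Y] on one side, and their expectation [c] is a constant weight
   on the other. Equality is then needed only with an indicator in place of [f a], which is the
   induction hypothesis for [f'] and [r']. *)
rewrite (@ge0_integral_comp_eq _ _ _ _ _ P P (X a) (X a) Y (fun=> c)) //.
- by rewrite (cst_mul _ (r a)) // ?hr // (perm_big _ pm) big_cons.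
- exact: mX.
- exact: mX.
move=> B mB.
pose f' j := if j == a then \1_B else f j.
pose r' j := if j == a then fine (P (X a @^-1` B)) else r j.
have hB : (\int[P]_w (\1_B (X a w))%:E = (r' a)%:E)%E.
  by rewrite integral_preimage // /r' eqxx fineK // fin_num_measure //
    -[A in measurable A]setTI; exact: mX.
have m1B : measurable_fun setT (\1_B : R -> R) by exact: measurable_indic.
rewrite (cst_mul _ (r' a) m1B) //.
have : (\int[P]_w (\prod_(j <- s) f' j (X j w))%:E = (\prod_(j <- s) r' j)%:E)%E.
  apply: IH.
  - by move=> j; rewrite /f'; case: ifP => // _; exact: measurable_indic.
  - by move=> j x; rewrite /f'; case: ifP => // _.
  - move=> j js; rewrite /f' /r'; case: ifPn => [/eqP ->|_]; last exact: hr.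
    by rewrite hB /r' eqxx.
  - move=> j js jg; rewrite /f'; case: ifPn => [_|ja]; first by exists B.
    by apply: fB => //; rewrite inE negb_or ja.
rewrite (perm_big _ pm) big_cons /=.
rewrite (eq_big_seq r) => [<-|j /remE [ja _]]; last by rewrite /r' (negbTE ja).
apply: eq_integral => w _; rewrite (perm_big _ pm) big_cons /= /f' eqxx.
by congr (_ * _)%:E; apply: eq_big_seq => j /remE [/negbTE -> _].
Qed.

End independence.

(** * Transforms and tails of exponential laws *)

Section exponential_law.
Context {R : realType} {d : measure_display} {T : measurableType d}.
Variables (P : probability T R) (tau : T -> R) (r : R).
Hypotheses (r_gt0 : 0 < r) (mtau : measurable_fun setT tau).
Hypothesis law : forall B, measurable B ->
  P (tau @^-1` B) = exponential_prob r B.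

Let mpre (B : set R) : measurable B -> measurable (tau @^-1` B).
Proof. by move=> mB; rewrite -[A in measurable A]setTI; exact: mtau. Qed.

(** Multiplying the density of rate [r] by [expR (c * x)] gives [r / (r - c)] times the density of
    rate [r - c], which has mass 1. Negative [c] is included. *)
Lemma exponential_mgf (c : R) : c < r ->
  (\int[P]_w (expR (c * tau w))%:E = (r / (r - c))%:E)%E.
Proof.
move=> cr; have rc : 0 < r - c by rewrite subr_gt0.
have mexp : measurable_fun setT (fun x : R => expR (c * x)).
  apply: (@measurableT_comp _ _ _ R R R expR setT ( *%R c)) => //.
have mpdf := @measurable_exponential_pdf R r.
have pdf_ge0 x : 0 <= exponential_pdf r x by rewrite exponential_pdf_ge0 // ltW.
transitivity (\int[P]_w (expR (c * tau w) * cst 1 w)%:E)%E.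
  by apply: eq_integral => w _; rewrite mulr1.
rewrite (@ge0_integral_comp_eq _ _ _ _ _ P lebesgue_measure tau id (cst 1)
  (exponential_pdf r) mtau _ _ _ _ _ _ (fun x => expR (c * x))) //; last first.
- move=> B mB; transitivity (P (tau @^-1` B)).
    under eq_integral do rewrite mulr1.
    by rewrite (_ : (fun w => _) = (fun w => (\1_(tau @^-1` B) w)%:E)) //
      integral_indic ?setIT //; exact: mpre.
  rewrite law // /exponential_prob [LHS]integral_mkcond.
  apply: eq_integral => x _; rewrite patchE indicE.
  by case: ifPn => _; rewrite ?mul1r ?mul0r.
transitivity (\int[lebesgue_measure]_x
    ((r / (r - c))%:E * (exponential_pdf (r - c) x)%:E))%E.
  apply: eq_integral => x _; rewrite -EFinM; congr EFin.
  have [x0|x0] := leP 0 x; last by rewrite !lt0_exponential_pdf // !mulr0.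
  rewrite !exponential_pdfE // mulrCA [RHS]mulrA divfK ?gt_eqF //.
  by congr (_ * _); rewrite -expRD; congr expR; ring.
rewrite ge0_integralZl_EFin //.
- by rewrite integral_exponential_pdf // mule1.
- by move=> x _; rewrite lee_fin exponential_pdf_ge0 // ltW.
- by apply/measurable_EFinP; exact: measurable_exponential_pdf.
- by rewrite divr_ge0 // ltW.
Qed.

Lemma exponential_le0 : P (tau @^-1` `]-oo, 0]) = 0%E.
Proof.
rewrite law // /exponential_prob.
(* The density does not vanish at 0, so this Lebesgue-null endpoint is removed first. *)
rewrite -integral_itv_bndo_bndc; last first.
  apply/measurable_funTS/measurable_EFinP; exact: measurable_exponential_pdf.
apply: integral0_eq => x /=; rewrite in_itv /= => x0.
by rewrite lt0_exponential_pdf.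
Qed.

Lemma exponential_tail (c : R) : 0 < c ->
  P (tau @^-1` `]c, +oo[) = (expR (- (r * c)))%:E.
Proof.
move=> c0.
have -> : tau @^-1` `]c, +oo[ = ~` (tau @^-1` `]-oo, c]).
  by rewrite preimage_setC setCitvl.
rewrite probability_setC; last exact: mpre.
have -> : tau @^-1` `]-oo, c] = (tau @^-1` `]-oo, 0[) `|` (tau @^-1` `[0, c]).
  rewrite -preimage_setU; congr (_ @^-1` _); apply/seteqP; split => x /=;
    rewrite !in_itv /=; lra.
rewrite measureU //=; [|exact: mpre|exact: mpre|]; last first.
  by apply/seteqP; split => x //= -[]; rewrite !in_itv /=; lra.
have -> : P (tau @^-1` `]-oo, 0[) = 0%E.
  rewrite law // /exponential_prob; apply: integral0_eq => x /=.
  by rewrite in_itv /= => x0; rewrite lt0_exponential_pdf.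
rewrite law // exponential_prob_itv0c // add0e.
by apply: (congr1 EFin (_ : 1 - (1 - _) = _)); rewrite mulNr; ring.
Qed.

End exponential_law.

(** * The urn as a race between partial sums *)

Section urn_path.
Context {R : realType} {T : Type}.
Variables (A : nat) (X0 : nat -> nat) (tau : nat -> nat -> T -> R).
Local Notation psum := (psum X0 tau).
Local Notation Xi := (Xi X0 tau).
Local Notation jump_time := (jump_time A X0 tau).

(** The values of [Xi] are integers or infinite, so exceeding [m] only says that no state up to [m]
    qualifies for the infimum. This replaces infima by finitely many inequalities on every path,
    including those where partial sums are not monotone. *)
Lemma Xi_gtP i t w m : ((m%:R)%:E < Xi i t w)%E <->
  (forall k, (X0 i <= k <= m)%N -> ((psum i k w)%:E <= t)%E).
Proof.
split=> [mX k /andP[ik km]|H].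
  rewrite leNgt; apply: contraTN mX => tk; rewrite -leNgt.
  apply: (@le_trans _ _ (k%:R)%:E); last by rewrite lee_fin ler_nat.
  by apply: ereal_inf_lbound; exists k.
apply: (@lt_le_trans _ _ (m.+1%:R)%:E); first by rewrite lte_fin ltr_nat.
apply/ereal_infP => _ [k [ik tk] <-]; rewrite lee_fin ler_nat ltnNge.
by apply/negP => km; move: tk; rewrite ltNge H // ik.
Qed.

Lemma le_Xi i t t' w : (t <= t')%E -> (Xi i t w <= Xi i t' w)%E.
Proof.
move=> tt'; apply/ereal_infP => _ [k [ik tk] <-]; apply: ereal_inf_lbound.
by exists k => //; split => //; exact: le_lt_trans tk.
Qed.

(** An increase of [Xi] crosses an integer level; the countable choice of levels is what
    measurability needs. *)
Lemma Xi_ltP i t t' w : (Xi i t w < Xi i t' w)%E <->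
  exists m : nat, ~ ((m%:R)%:E < Xi i t w)%E /\ ((m%:R)%:E < Xi i t' w)%E.
Proof.
split=> [/ereal_inf_lt [_ [k [ik tk] <-]] kt'|[m [/negP]]].
  exists k; split=> //; apply/negP; rewrite -leNgt.
  by apply: ereal_inf_lbound; exists k.
by rewrite -leNgt => /le_lt_trans; exact.
Qed.

(** [Xi] is nondecreasing in time, so any change after the current jump is an increase. *)
Lemma jump_time_step_ltP n w s : (jump_time n.+1 w < s)%E <->
  exists t : R, [/\ (t%:E < s)%E, (jump_time n w < t%:E)%E &
    exists i, (1 <= i <= A)%N /\ (Xi i (jump_time n w) w < Xi i t%:E w)%E].
Proof.
split=> [/ereal_inf_lt [_ [t [nt [i [i1 iA iX]]] <-]] ts|[t [ts nt [i [iA iX]]]]].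
  exists t; split=> //; exists i; rewrite i1 iA; split=> //.
  by rewrite lt_neqAle le_Xi ?(ltW nt) // andbT eq_sym; apply/eqP.
apply: le_lt_trans ts; apply: ereal_inf_lbound; exists t => //; split => //.
have /andP[? ?] := iA.
by exists i; split => // e; rewrite e ltxx in iX.
Qed.

(** An increase seen at [t] persists at later times, so [t] can be moved up to a rational below [s].
    The resulting union is countable. *)
Lemma jump_time_step_rat_ltP n w (s : R) : (jump_time n.+1 w < s%:E)%E <->
  exists q : rat, [/\ ratr q < s, (jump_time n w < (ratr q)%:E)%E &
    exists i, (1 <= i <= A)%N /\
      (Xi i (jump_time n w) w < Xi i (ratr q)%:E w)%E].
Proof.
rewrite jump_time_step_ltP; split=> [[t [ts nt [i [iA iX]]]]|[q [qs nq iX]]].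
  have [q /andP[tq qs]] := rat_in_itvoo ts.
  exists q; split=> //; first by rewrite (lt_trans nt) // lte_fin.
  by exists i; split=> //; rewrite (lt_le_trans iX) // le_Xi // lee_fin ltW.
by exists (ratr q); split.
Qed.

Lemma le_jump_time_step n w : (jump_time n w <= jump_time n.+1 w)%E.
Proof. by apply/ereal_infP => _ [t [/ltW nt _] <-]. Qed.

Lemma urn_lim_gtP i w m : ((m%:R)%:E < urn_lim A X0 tau i w)%E <->
  exists n, ((m%:R)%:E < Xi i (jump_time n w) w)%E.
Proof.
have nd : nondecreasing_seq (fun n => urn A X0 tau i n w).
  by apply/nondecreasing_seqP => n; apply/le_Xi/le_jump_time_step.
rewrite /urn_lim (cvg_lim _ (ereal_nondecreasing_cvgn nd)) //.
split=> [/ereal_sup_gt [_ [n _ <-]]|[n mn]]; first by exists n.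
by apply: (lt_le_trans mn); apply: ereal_sup_ubound; exists n.
Qed.

Lemma psumS i k w : (X0 i <= k.+1)%N -> psum i k.+1 w = psum i k w + tau i k.+1 w.
Proof. by move=> ik; rewrite /Defs.psum big_nat_recr. Qed.

(** Supplies the next partial sum after a jump time. *)
Lemma seq_next_above (V : seq R) (t : \bar R) :
  (exists2 v, v \in V & (t < v%:E)%E) ->
  exists v, [/\ v \in V, (t < v%:E)%E &
    forall u, u \in V -> (t < u%:E)%E -> v <= u].
Proof.
elim: V => [[v]//|a V IH [v vV tv]].
have [[u uV tu]|nV] := pselect (exists2 v, v \in V & (t < v%:E)%E); last first.
  exists a; move: vV; rewrite inE => /predU1P[<-|vV]; last by case: nV; exists v.
  split=> // [|u]; first by rewrite mem_head.
  by rewrite inE => /predU1P[->//|uV tu]; case: nV; exists u.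
have [b [bV tb bmin]] := IH (ex_intro2 _ _ u uV tu).
have [ta|ta] := boolP (t < a%:E)%E; last first.
  exists b; split=> // [|y]; first by rewrite inE bV orbT.
  by rewrite inE => /predU1P[->|]; [rewrite (negbTE ta)|exact: bmin].
have [ab|ba] := leP a b.
  exists a; split=> // [|y]; first by rewrite mem_head.
  by rewrite inE => /predU1P[->//|yV ty]; rewrite (le_trans ab) // bmin.
exists b; split=> // [|y]; first by rewrite inE bV orbT.
by rewrite inE => /predU1P[->|]; [rewrite ltW|exact: bmin].
Qed.

(* Each jump passes a new partial sum, so no time that finitely many partial
   sums dominate can bound all the jump times. *)
Lemma jump_time_unbounded w (L : R) :
  (0 < A)%N ->
  (forall i, (1 <= i <= A)%N -> exists k, (X0 i <= k)%N /\ L < psum i k w) ->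
  exists n, (L%:E <= jump_time n w)%E.
Proof.
move=> A0 HL; apply: contrapT => /forallNP H.
have {}H n : (jump_time n w < L%:E)%E by rewrite ltNge; apply/negP/H.
have /choice [K hK] : forall i, exists k, (1 <= i <= A)%N ->
    (X0 i <= k)%N /\ L < psum i k w.
  move=> i; have [iA|//] := boolP (1 <= i <= A)%N; last by exists 0%N.
  by have [k ?] := HL i iA; exists k.
pose V := [seq psum i k w | i <- index_iota 1 A.+1, k <- index_iota (X0 i) (K i).+1].
have inV i k : (1 <= i <= A)%N -> (X0 i <= k <= K i)%N -> psum i k w \in V.
  by move=> iA kK; apply/allpairsPdep; exists i, k; rewrite !mem_index_iota !ltnS.
(* This count is at most the size of [V], yet it grows at every jump: the least entry [v] above the
   current jump time is passed by the next one. *)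
pose c (t : \bar R) := count (fun v : R => (v%:E <= t)%E) V.
have cS n : (c (jump_time n w) < c (jump_time n.+1 w))%N.
  have [|v [vV nv vmin]] := @seq_next_above V (jump_time n w).
    have [_ LK] := hK 1%N A0; exists (psum 1%N (K 1%N) w).
      by apply: inV; rewrite ?A0 // leqnn andbT; have [] := hK 1%N A0.
    by rewrite (lt_trans (H n)) // lte_fin.
  have vS : (v%:E <= jump_time n.+1 w)%E.
    rewrite leNgt; apply/negP => /jump_time_step_ltP [t [tv nt [i [iA]]]].
    move=> /Xi_ltP [m [mn mt]]; apply: mn; apply/Xi_gtP => k /andP[ik km].
    rewrite leNgt; apply/negP => nk.
    have kt : psum i k w <= t by move/Xi_gtP : mt => /(_ k); rewrite ik km; exact.
    (* Either [psum i k] is itself an entry of [V] between the current jump and [v], or [k] lies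
       beyond the listed range and [psum i (K i)], which exceeds [L], is such an entry. *)
    have [kK|Kk] := leqP k (K i).
      have := vmin _ (inV i k iA _) nk; rewrite ik => /(_ kK).
      by rewrite leNgt (le_lt_trans kt).
    have [iK LK] := hK i iA.
    have := vmin _ (inV i (K i) iA _) _; rewrite iK leqnn => /(_ isT).
    have nK : (jump_time n w < (psum i (K i) w)%:E)%E.
      by rewrite (lt_trans (H n)) // lte_fin.
    have Kt : psum i (K i) w <= t.
      by move/Xi_gtP : mt => /(_ (K i)); rewrite iK (leq_trans (ltnW Kk) km); exact.
    by move=> /(_ nK); rewrite leNgt (le_lt_trans Kt).
  rewrite /c !(permP (perm_to_rem vV)) /= vS leNgt nv add0n add1n ltnS.
  by apply: sub_count => u /= /le_trans; apply; exact: le_jump_time_step.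
have cn n : (n <= c (jump_time n w))%N.
  by elim: n => // n IH; rewrite (leq_ltn_trans IH).
by have := leq_trans (cn (size V).+1) (count_size _ _); rewrite ltnn.
Qed.

(** Jump times never reach an explosion time, so passing state [x] forces every other agent to have
    a partial sum beyond [psum 1 x]. Conversely, if all agents have one, the jump times reach
    [psum 1 x] by [jump_time_unbounded]. *)
Lemma urn_lim_gt_psum (w : T) (x : nat) :
  (forall i k, (1 <= i <= A)%N -> (X0 i <= k)%N -> 0 < tau i k w) ->
  (0 < A)%N -> (X0 1 <= x)%N ->
  ((x%:R)%:E < urn_lim A X0 tau 1 w)%E <->
  (forall i, (2 <= i <= A)%N -> exists k, (X0 i <= k)%N /\ psum 1 x w < psum i k w).
Proof.
move=> tau0 A0 Xx.
have psum_step i k : (1 <= i <= A)%N -> (X0 i <= k)%N -> psum i k w < psum i k.+1 w.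
  by move=> iA ik; rewrite psumS ?leqW // ltrDl tau0 // leqW.
(* If a jump occurs before [psum i k], the departure of agent [i] from state [k] forces the next
   jump no later than [psum i k], hence before [psum i k.+1]. *)
have alive n i : (1 <= i <= A)%N ->
    exists k, (X0 i <= k)%N /\ (jump_time n w < (psum i k w)%:E)%E.
  elim: n i => [|n IH] i iA.
    exists (X0 i); split => //=.
    by rewrite lte_fin /Defs.psum big_nat1 tau0.
  have [k [ik nk]] := IH i iA; exists k.+1; split; first exact: leqW.
  apply/jump_time_step_ltP; exists (psum i k w).
  split=> //; first by rewrite lte_fin psum_step.
  exists i; split=> //; apply/Xi_ltP; exists k; split; last first.
    apply/Xi_gtP => l /andP[il lk]; rewrite lee_fin.
    elim: k {ik nk} lk => [|k IHk] lk; first by move: lk; rewrite leqn0 => /eqP ->.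
    move: lk; rewrite leq_eqVlt => /predU1P[->//|lk].
    by rewrite (le_trans (IHk lk)) // ltW // psum_step // (leq_trans il).
  by move=> /Xi_gtP /(_ k); rewrite ik leqnn leNgt nk => /(_ isT).
split=> [/urn_lim_gtP [n /Xi_gtP H] i /andP[i2 iA]|H].
  have [|k [ik nk]] := alive n i; first by rewrite iA ltnW.
  exists k; split => //; rewrite -lte_fin; apply: le_lt_trans nk.
  by apply: H; rewrite Xx leqnn.
have [//||n Ln] := @jump_time_unbounded w (psum 1 x w).
  move=> i /andP[i1 iA]; move: i1; rewrite leq_eqVlt => /predU1P[<-|i2].
    by exists x.+1; split; [exact: leqW|rewrite psum_step ?A0].
  by apply: H; rewrite i2.
apply/urn_lim_gtP; exists n; apply/Xi_gtP => k /andP[Xk kx].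
apply: le_trans Ln; rewrite lee_fin.
elim: x {Xx H} kx => [|x IH]; first by rewrite leqn0 => /eqP ->.
rewrite leq_eqVlt => /predU1P[->//|kx].
by rewrite (le_trans (IH kx)) // ltW // psum_step ?A0 // (leq_trans Xk).
Qed.
End urn_path.

(** * Measurability of the limit events *)

Section urn_measurable.
Context {R : realType} {d : measure_display} {T : measurableType d}.
Variables (A : nat) (X0 : nat -> nat) (tau : nat -> nat -> T -> R).
Hypothesis mtau : forall i k, (1 <= i <= A)%N -> (X0 i <= k)%N ->
  measurable_fun setT (tau i k).
Local Notation psum := (psum X0 tau).
Local Notation Xi := (Xi X0 tau).
Local Notation jump_time := (jump_time A X0 tau).

Lemma measurable_psum i k : (1 <= i <= A)%N -> measurable_fun setT (psum i k).
Proof.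
move=> iA; rewrite /Defs.psum.
(* [tau i l] is assumed measurable only from [X0 i] on, while [measurable_sum] asks for every index;
   the other terms are set to 0. *)
rewrite (_ : (fun w => _) = (fun w => \sum_(X0 i <= l < k.+1)
    (if (X0 i <= l)%N then tau i l w else 0))); last first.
  by apply/funext => w; apply: eq_big_nat => l /andP[->].
by apply: measurable_sum => l; have [il|//] := boolP (X0 i <= l)%N; exact: mtau.
Qed.

Let measurable_lt_gt (Y : T -> R) (c : R) : measurable_fun setT Y ->
  measurable [set w | c < Y w].
Proof.
move=> mY; have -> : [set w | c < Y w] = setT `&` (Y @^-1` `]c, +oo[).
  by apply/seteqP; split => w /=; rewrite in_itv /= andbT; [move=> ?; split|case].
exact: mY.
Qed.

(** The time [g] is random so that both jump times and constant rational times are covered. By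
    [Xi_gtP], the event says that no rational separates [g] from a larger partial sum. *)
Let measurable_Xi_gt i m (g : T -> \bar R) : (1 <= i <= A)%N ->
  (forall s : R, measurable [set w | (g w < s%:E)%E]) ->
  measurable [set w | ((m%:R)%:E < Xi i (g w) w)%E].
Proof.
move=> iA mg.
have -> : [set w | ((m%:R)%:E < Xi i (g w) w)%E] =
    \bigcap_(k in [set k | (X0 i <= k <= m)%N])
      ~` (\bigcup_(q : rat) ([set w | (g w < (ratr q)%:E)%E] `&`
                             [set w | ratr q < psum i k w])).
  apply/seteqP; split => w /=.
    move=> /Xi_gtP H k /= /H kg [q _ [/= gq qk]].
    have {}qk : ((ratr q)%:E < (psum i k w)%:E)%E by [].
    by have := lt_le_trans gq (le_trans (ltW qk) kg); rewrite ltxx.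
  move=> H; apply/Xi_gtP => k /H /= nH; rewrite leNgt; apply/negP => gk.
  apply: nH; have [r gr rk] : exists2 r : R, (g w < r%:E)%E & r < psum i k w.
    case: (g w) gk => [r||] //= gk; last first.
      by exists (psum i k w - 1); rewrite ?ltNyr // ltrBlDr ltrDl.
    exists ((r + psum i k w) / 2); rewrite ?lte_fin; move: gk; rewrite lte_fin; lra.
  have [q /andP[rq qk]] := rat_in_itvoo rk.
  by exists q => //; split => //=; rewrite (lt_trans gr).
apply: bigcap_measurableType => k _; apply: measurableC.
apply: bigcupT_measurable_rat => q; apply: measurableI => //.
by apply: measurable_lt_gt; exact: measurable_psum.
Qed.

Let measurable_jump_time n (s : R) : measurable [set w | (jump_time n w < s%:E)%E].
Proof.
elim: n s => [|n IH] s.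
  have [s0|s0] := boolP (0 < s)%R.
    rewrite (_ : [set w | _] = setT) //; apply/seteqP; split => w //= _.
  rewrite (_ : [set w | _] = set0) //; apply/seteqP; split => w //=.
  by rewrite lte_fin (negbTE s0).
have -> : [set w | (jump_time n.+1 w < s%:E)%E] =
  \bigcup_(q : rat) (if ratr q < s :> R then
    [set w | (jump_time n w < (ratr q)%:E)%E] `&`
    (\bigcup_(i in [set i | (1 <= i <= A)%N])
     \bigcup_m (~` [set w | ((m%:R)%:E < Xi i (jump_time n w) w)%E] `&`
                [set w | ((m%:R)%:E < Xi i (ratr q)%:E w)%E])) else set0).
  apply/seteqP; split => w /=.
    move=> /jump_time_step_rat_ltP [q [qs nq [i [iA /Xi_ltP [m [m1 m2]]]]]].
    exists q => //; rewrite qs; split => //; exists i => //; exists m => //.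
  move=> [q _]; case: ifP => // qs [/= nq [i iA [m _ [/= m1 m2]]]].
  apply/jump_time_step_rat_ltP; exists q; split => //; exists i; split => //.
  by apply/Xi_ltP; exists m.
apply: bigcupT_measurable_rat => q; case: ifP => // qs.
apply: measurableI => //; apply: bigcup_measurable => i iA.
apply: bigcupT_measurable => m; apply: measurableI.
  by apply: measurableC; exact: measurable_Xi_gt.
apply: (@measurable_Xi_gt i m (fun=> (ratr q)%:E)) => // t.
have [qt|qt] := boolP ((ratr q)%:E < t%:E)%E.
  by rewrite (_ : [set w | _] = setT) //; apply/seteqP; split.
by rewrite (_ : [set w | _] = set0) //; apply/seteqP; split.
Qed.

(* [P] is unspecified on nonmeasurable sets, so this is needed without any
   assumption on the sample path, in particular on the null set where sojourn
   times are not positive. *)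
Lemma measurable_urn_lim_gt i (x : nat) : (1 <= i <= A)%N ->
  measurable [set w | ((x%:R)%:E < urn_lim A X0 tau i w)%E].
Proof.
move=> iA.
have -> : [set w | ((x%:R)%:E < urn_lim A X0 tau i w)%E] =
    \bigcup_n [set w | ((x%:R)%:E < Xi i (jump_time n w) w)%E].
  apply/seteqP; split => w /=; first by move=> /urn_lim_gtP [n xn]; exists n.
  by move=> [n _ xn]; apply/urn_lim_gtP; exists n.
by apply: bigcupT_measurable => n; exact: measurable_Xi_gt.
Qed.
End urn_measurable.

(** * Tail bounds *)

Section measure_bounds.
Context {R : realType} {d : measure_display} {T : measurableType d}.
Variable P : probability T R.

Lemma measurable_ltr_set (Y Z : T -> R) :
  measurable_fun setT Y -> measurable_fun setT Z -> measurable [set w | Y w < Z w].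
Proof.
move=> mY mZ.
have -> : [set w | Y w < Z w] = setT `&` ((Z \- Y) @^-1` `]0, +oo[).
  by apply/seteqP; split => w /=; rewrite in_itv /= andbT subr_gt0;
    [move=> ?; split|case].
exact: measurable_funB.
Qed.

(** The exceptional set [Z] need not be measurable; a measurable null cover replaces it. *)
Lemma le_measure_negligible (A B Z : set T) : measurable A -> measurable B ->
  P.-negligible Z -> A `<=` B `|` Z -> (P A <= P B)%E.
Proof.
move=> mA mB [Y [mY PY ZY]] AB.
have : (P A <= P (B `|` Y))%E.
  apply: le_measure; rewrite ?inE //; first exact: measurableU.
  by move=> w /AB [Bw|/ZY Yw]; [left|right].
move=> /le_trans; apply.
rewrite (le_trans (measureU2 P mB mY)) // [X in (_ + X)%E](_ : _ = 0%E) //.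
by rewrite adde0.
Qed.

Lemma markov_indicator (G : set T) (h : T -> R) : measurable G ->
  measurable_fun setT h -> (forall w, 0 <= h w) -> (forall w, G w -> 1 <= h w) ->
  (P G <= \int[P]_w (h w)%:E)%E.
Proof.
move=> mG mh h0 h1; rewrite -[G in (P G <= _)%E]setIT -integral_indic //.
apply: ge0_le_integral => //.
- by apply/measurable_EFinP; exact: measurable_indic.
- exact/measurable_EFinP.
- move=> w _; rewrite lee_fin indicE.
  by have [/set_mem/h1|] := boolP (w \in G).
Qed.
End measure_bounds.

(** Turns divergence of the sum of inverse rates into divergence of the product in the Laplace
    transform of a partial sum. *)
Lemma ler_1sum_prod (R : realDomainType) (I : eqType) (s : seq I) (a : I -> R) :
  (forall i, i \in s -> 0 <= a i) -> 1 + \sum_(i <- s) a i <= \prod_(i <- s) (1 + a i).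
Proof.
elim: s => [|i s IH] a0; first by rewrite !big_nil addr0.
have ai := a0 i (mem_head _ _).
have {}a0 j : j \in s -> 0 <= a j by move=> js; apply: a0; rewrite inE js orbT.
have s0 : 0 <= \sum_(j <- s) a j by rewrite big_seq sumr_ge0.
have := IH a0; rewrite !big_cons; nra.
Qed.

(** * Upper and lower bounds on the escape probability *)

Section urn_tail.
Context {R : realType} {d : measure_display} {T : measurableType d}.
Variables (P : probability T R) (A : nat) (F : nat -> nat -> R) (X0 : nat -> nat).
Variable tau : nat -> nat -> T -> R.
Hypothesis F_gt0 : forall i k, (1 <= i <= A)%N -> (1 <= k)%N -> 0 < F i k.
Hypothesis X0_ge1 : forall i, (1 <= i <= A)%N -> (1 <= X0 i)%N.
Hypothesis mtau : forall i k, (1 <= i <= A)%N -> (X0 i <= k)%N ->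
  measurable_fun setT (tau i k).
Hypothesis tau_law : forall i k, (1 <= i <= A)%N -> (X0 i <= k)%N ->
  forall B : set R, measurable B -> P (tau i k @^-1` B) = exponential_prob (F i k) B.
Hypothesis tau_indep : mutually_independent P
  [set ik : nat * nat | (1 <= ik.1 <= A)%N /\ (X0 ik.1 <= ik.2)%N]
  (fun ik => tau ik.1 ik.2).
Local Notation psum := (psum X0 tau).
Local Notation escape x := [set w | ((x%:R)%:E < urn_lim A X0 tau 1 w)%E].

Let F_pos i k : (1 <= i <= A)%N -> (X0 i <= k)%N -> 0 < F i k.
Proof. by move=> iA ik; rewrite F_gt0 // (leq_trans _ ik) // X0_ge1. Qed.

(** [expectation_prod] is applied to the duplicate-free list [J] of pairs (agent, state), then
    regrouped by agent. *)
Lemma expectation_blocks (s : seq nat) (n : nat -> nat) (g : nat -> R -> R)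
    (r : nat -> nat -> R) :
  uniq s -> (forall i, i \in s -> (1 <= i <= A)%N) ->
  (forall i, measurable_fun setT (g i)) -> (forall i x, 0 <= g i x) ->
  (forall i k, i \in s -> (X0 i <= k <= n i)%N ->
    \int[P]_w (g i (tau i k w))%:E = (r i k)%:E)%E ->
  (\int[P]_w (\prod_(i <- s) \prod_(X0 i <= k < (n i).+1) g i (tau i k w))%:E =
   (\prod_(i <- s) \prod_(X0 i <= k < (n i).+1) r i k)%:E)%E.
Proof.
move=> us sA mg g0 hr.
pose J := [seq (i, k) | i <- s, k <- index_iota (X0 i) (n i).+1].
have JP ik : ik \in J -> ik.1 \in s /\ (X0 ik.1 <= ik.2 <= n ik.1)%N.
  by move=> /allpairsPdep [i [k [is_]]]; rewrite mem_index_iota ltnS => kn ->.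
have := @expectation_prod _ _ _ P _ _ _ tau_indep _ J (fun ik => g ik.1)
  (fun ik => r ik.1 ik.2).
rewrite !big_allpairs_dep /= => <- //.
- apply: eq_integral => w _; congr EFin; rewrite big_allpairs_dep.
  by apply: eq_bigr => i _.
- by move=> ik [iA ik_]; exact: mtau.
- apply: allpairs_uniq_dep => //.
  + by move=> i _; exact: iota_uniq.
  + by move=> [i k] [j l] _ _ /= [-> ->].
- by move=> ik /JP [/sA iA /andP[]].
- by move=> ik /JP [is_ kn]; exact: hr.
Qed.

Lemma prod_expR_psum i n c w :
  \prod_(X0 i <= k < n.+1) expR (c * tau i k w) = expR (c * psum i n w).
Proof. by rewrite /Defs.psum mulr_sumr expR_sum. Qed.

Lemma negligible_nonpos_sojourn : P.-negligible [set w |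
  ~ forall i k, (1 <= i <= A)%N -> (X0 i <= k)%N -> 0 < tau i k w].
Proof.
apply: (@negligibleS _ _ _ _ (\bigcup_i \bigcup_k
  [set w | [/\ (1 <= i <= A)%N, (X0 i <= k)%N & tau i k w <= 0]])).
  move=> w /= /existsNP [i /existsNP [k /not_implyP [iA /not_implyP [ik]]]].
  by move=> /negP; rewrite -leNgt => t0; exists i => //; exists k.
apply: negligible_bigcup => i; apply: negligible_bigcup => k.
have [iA|iA] := boolP (1 <= i <= A)%N; last first.
  by apply: negligibleS (negligible_set0 _) => w /= [].
have [ik|ik] := boolP (X0 i <= k)%N; last first.
  by apply: negligibleS (negligible_set0 _) => w /= [].
exists (tau i k @^-1` `]-oo, 0]); split.
- by rewrite -[S in measurable S]setTI; exact: mtau.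
- exact: (exponential_le0 (tau_law iA ik)).
- by move=> w /= [_ _]; rewrite in_itv.
Qed.

(** Agent 1 joins the blocks of [s] with an exponential factor. The free [g] is an exponential in
    the upper bound and an indicator in the lower bound. *)
Lemma expectation_race (s : seq nat) (n : nat -> nat) (g : nat -> R -> R)
    (r : nat -> nat -> R) (c : R) (x : nat) :
  (0 < A)%N -> (forall k, (X0 1 <= k)%N -> c < F 1 k) ->
  uniq s -> (forall i, i \in s -> (2 <= i <= A)%N) ->
  (forall i, measurable_fun setT (g i)) -> (forall i y, 0 <= g i y) ->
  (forall i k, i \in s -> (X0 i <= k <= n i)%N ->
    \int[P]_w (g i (tau i k w))%:E = (r i k)%:E)%E ->
  (\int[P]_w (expR (c * psum 1 x w) *
      \prod_(i <- s) \prod_(X0 i <= k < (n i).+1) g i (tau i k w))%:E =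
   (\prod_(X0 1 <= k < x.+1) (F 1 k / (F 1 k - c)) *
      \prod_(i <- s) \prod_(X0 i <= k < (n i).+1) r i k)%:E)%E.
Proof.
move=> A0 cF us sA mg g0 hr.
have s1 i : i \in s -> (i == 1%N) = false.
  by move=> /sA /andP[i2 _]; apply/negbTE; rewrite neq_ltn i2 orbT.
have sA' i : i \in s -> (1 <= i <= A)%N.
  by move=> /sA /andP[i2 ->]; rewrite ltnW.
pose n' i := if i == 1%N then x else n i.
pose g' i := if i == 1%N then (fun y => expR (c * y)) else g i.
pose r' i k := if i == 1%N then F 1%N k / (F 1%N k - c) else r i k.
have <- : \prod_(i <- (1%N :: s)) \prod_(X0 i <= k < (n' i).+1) r' i k =
    \prod_(X0 1 <= k < x.+1) (F 1 k / (F 1 k - c)) *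
      \prod_(i <- s) \prod_(X0 i <= k < (n i).+1) r i k.
  rewrite big_cons; congr (_ * _); apply: eq_big_seq => i /s1 i1.
  by rewrite /n' /r' i1.
rewrite -(@expectation_blocks _ n' g').
- apply: eq_integral => w _; congr EFin; rewrite big_cons -prod_expR_psum.
  by congr (_ * _); apply: eq_big_seq => i /s1 i1; rewrite /n' /g' i1.
- by rewrite /= us andbT; apply/negP => /s1.
- by move=> i; rewrite inE => /predU1P[->|/sA']; rewrite ?A0.
- move=> i; rewrite /g'; case: ifP => _ //.
  by apply: (@measurableT_comp _ _ _ R R R expR setT ( *%R c)).
- by move=> i y; rewrite /g'; case: ifP => _ //; exact: expR_ge0.
- move=> i k; rewrite inE => /predU1P[->|is_] /andP[ik kn].
    rewrite /g' /r' /= (exponential_mgf (F_pos _ ik) (mtau _ ik) (tau_law _ ik)) ?A0 //.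
    exact: cF.
  by rewrite /g' /r' s1 // hr // ik; move: kn; rewrite /n' s1.
Qed.

(* On the event, [expR (\sum_(i <- s) theta i * (psum i _ - psum 1 x))] is at
   least 1. *)
Lemma race_upper_bound (s : seq nat) (theta : nat -> R) (x N : nat) :
  (0 < A)%N -> uniq s -> (forall i, i \in s -> (2 <= i <= A)%N) ->
  (forall i, i \in s -> 0 <= theta i) ->
  (forall i k, i \in s -> (X0 i <= k)%N -> theta i < F i k) ->
  (P [set w | forall i, i \in s -> (psum 1 x w < psum i (X0 i + N)%N w)%R] <=
   ((\prod_(X0 1 <= k < x.+1) (F 1 k / (F 1 k + \sum_(i <- s) theta i))) *
    \prod_(i <- s) \prod_(X0 i <= k < (X0 i + N).+1) (F i k / (F i k - theta i)))%:E)%E.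
Proof.
move=> A0 us sA th0 thF.
pose c := - \sum_(i <- s) theta i.
have c0 : c <= 0 by rewrite oppr_le0 big_seq sumr_ge0.
have sA' i : i \in s -> (1 <= i <= A)%N.
  by move=> /sA /andP[i2 ->]; rewrite ltnW.
have mp1 : measurable_fun setT (psum 1 x) by apply: (measurable_psum mtau); rewrite A0.
have := @expectation_race s (fun i => X0 i + N)%N (fun i y => expR (theta i * y))
  (fun i k => F i k / (F i k - theta i)) c x A0 _ us sA.
rewrite [in X in _ -> _ -> _ -> _ -> _ = X](eq_bigr (fun k =>
  F 1%N k / (F 1%N k + \sum_(i <- s) theta i))); last by move=> k _; rewrite opprK.
move=> <-.
- apply: markov_indicator.
  + rewrite (_ : [set w | _] = \bigcap_(i in [set` s])
      [set w | psum 1 x w < psum i (X0 i + N)%N w]) //.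
    apply: bigcap_measurableType => i /= /sA' iA; apply: measurable_ltr_set => //.
    exact: (measurable_psum mtau).
  + apply: measurable_funM.
      by apply: measurableT_comp => //; exact: measurable_funM.
    apply: measurable_prod => i /sA' iA; under eq_fun do rewrite prod_expR_psum.
    apply: measurableT_comp => //; apply: measurable_funM => //.
    exact: (measurable_psum mtau).
  + move=> w; rewrite mulr_ge0 ?expR_ge0 // prodr_ge0 // => i _.
    by rewrite prodr_ge0 // => k _; exact: expR_ge0.
  + move=> w Gw; under eq_bigr do rewrite prod_expR_psum.
    rewrite -expR_sum -expRD -[leLHS]expR0 ler_expR.
    rewrite /c mulNr mulr_suml -sumrN -big_split /=.
    rewrite big_seq sumr_ge0 // => i is_; have := Gw _ is_ => /ltW.
    by have := th0 i is_; nra.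
- by move=> k Xk; rewrite (le_lt_trans c0) // F_pos // A0.
- by move=> i; apply: (@measurableT_comp _ _ _ R R R expR setT ( *%R (theta i))).
- by move=> i y; exact: expR_ge0.
- move=> i k is_ /andP[ik _].
  have iA := sA' _ is_.
  by rewrite (exponential_mgf (F_pos iA ik) (mtau iA ik) (tau_law iA ik)) // thF.
Qed.

(** Explosion times are approached by partial sums at stage [N]; since [C] does not depend on [N],
    the bound of [race_upper_bound] survives the limit. *)
Lemma urn_tail_upper (s : seq nat) (theta : nat -> R) (C : R) (x : nat) :
  (0 < A)%N -> uniq s -> (forall i, i \in s -> (2 <= i <= A)%N) ->
  (forall i, i \in s -> 0 <= theta i) ->
  (forall i k, i \in s -> (X0 i <= k)%N -> theta i < F i k) ->
  (forall N, \prod_(i <- s) \prod_(X0 i <= k < (X0 i + N).+1)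
     (F i k / (F i k - theta i)) <= C) ->
  (X0 1 <= x)%N ->
  (P (escape x) <=
   (\prod_(X0 1 <= k < x.+1) (F 1 k / (F 1 k + \sum_(i <- s) theta i)) * C)%:E)%E.
Proof.
move=> A0 us sA th0 thF hC Xx.
have sA' i : i \in s -> (1 <= i <= A)%N.
  by move=> /sA /andP[i2 ->]; rewrite ltnW.
have mpsum i k : (1 <= i <= A)%N -> measurable_fun setT (psum i k).
  by move=> iA; exact: (measurable_psum mtau).
(* Asking for some [k] up to stage [N] makes [U] increasing on all paths. Where sojourns are
   positive, the last index works whenever some [k] does, which leads back to [race_upper_bound]. *)
pose U N := [set w | forall i, i \in s ->
  exists2 k, (X0 i <= k <= X0 i + N)%N & psum 1 x w < psum i k w].
have mU N : measurable (U N).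
  rewrite (_ : U N = \bigcap_(i in [set` s])
      \bigcup_(k in [set k | (X0 i <= k <= X0 i + N)%N])
      [set w | psum 1 x w < psum i k w]) //.
  apply: bigcap_measurableType => i /= /sA' iA; apply: bigcup_measurable => k _.
  by apply: measurable_ltr_set; apply: mpsum; rewrite ?A0.
have ndU : nondecreasing_seq U.
  move=> n m nm; apply/subsetPset => w Uw i /Uw [k /andP[ik kn] xk].
  by exists k => //; rewrite ik (leq_trans kn) // leq_add2l.
have mUU : measurable (\bigcup_n U n) by exact: bigcupT_measurable.
apply: (@le_trans _ _ (P (\bigcup_n U n))).
  apply: (le_measure_negligible _ _ negligible_nonpos_sojourn) => //.
    by apply: (measurable_urn_lim_gt mtau); rewrite A0.
  move=> w /= xw.
  have [t0|t0] := pselect (forall i k, (1 <= i <= A)%N -> (X0 i <= k)%N ->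
    0 < tau i k w); [left|by right].
  have H := (urn_lim_gt_psum t0 A0 Xx).1.
  have /choice [K hK] : forall i, exists k, i \in s ->
      (X0 i <= k)%N /\ psum 1 x w < psum i k w.
    move=> i; have [/sA iA|//] := boolP (i \in s); last by exists 0%N.
    by have [k ?] := H xw i iA; exists k.
  exists (\max_(i <- s) K i)%N => // i is_; exists (K i).
    by rewrite (hK i is_).1 (leq_trans (leq_bigmax_seq i is_ isT)) ?leq_addl.
  exact: (hK i is_).2.
have cU := @nondecreasing_cvg_mu _ _ _ P U mU mUU ndU.
rewrite -(cvg_lim _ cU) //; apply: lime_le; first by apply/cvg_ex; eexists; exact: cU.
apply: nearW => N; apply: (@le_trans _ _ (P [set w | forall i, i \in s ->
    (psum 1 x w < psum i (X0 i + N)%N w)%R])).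
  apply: (le_measure_negligible _ _ negligible_nonpos_sojourn) => //.
    rewrite (_ : [set w | _] = \bigcap_(i in [set` s])
      [set w | psum 1 x w < psum i (X0 i + N)%N w]) //.
    apply: bigcap_measurableType => i /= /sA' iA.
    by apply: measurable_ltr_set; apply: mpsum; rewrite ?A0.
  move=> w Uw.
  have [t0|t0] := pselect (forall i k, (1 <= i <= A)%N -> (X0 i <= k)%N ->
    0 < tau i k w); [left|by right].
  move=> i is_; have [k /andP[ik kN] xk] := Uw i is_.
  apply: (lt_le_trans xk); rewrite /Defs.psum [leRHS](big_cat_nat (leqW ik)) //=.
  rewrite lerDl big_nat sumr_ge0 // => l /andP[kl _].
  by rewrite ltW // t0 ?sA' // (leq_trans ik) // ltnW.
apply: (le_trans (race_upper_bound x N A0 us sA th0 thF)).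
rewrite lee_fin ler_wpM2l // big_nat prodr_ge0 // => k /andP[Xk _].
have Fk : 0 < F 1 k by rewrite F_pos ?A0.
have ? : 0 <= \sum_(i <- s) theta i by rewrite big_seq sumr_ge0.
by rewrite divr_ge0 // ?ltW // ltr_wpDr.
Qed.

(** The Laplace transform of [psum i n] at 1 is the inverse of the product of the [1 + (F i k)^-1],
    hence at most the inverse of one plus their sum. It tends to 0, and Markov's inequality at level
    [c] costs only the factor [expR c]. *)
Lemma negligible_no_explosion i (c : R) : (1 <= i <= A)%N ->
  (forall K, exists n, K <= \sum_(X0 i <= k < n.+1) (F i k)^-1) ->
  P.-negligible [set w | forall k, (X0 i <= k)%N -> psum i k w <= c].
Proof.
move=> iA div; have Xi := X0_ge1 iA.
have mpsum k : measurable_fun setT (psum i k) by exact: (measurable_psum mtau).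
have mle k : measurable [set w | psum i k w <= c].
  rewrite (_ : [set w | _] = ~` [set w | c < psum i k w]).
    by apply: measurableC; apply: measurable_ltr_set.
  by apply/seteqP; split => w /=; rewrite leNgt => /negP.
have bound n : (P [set w | (psum i n w <= c)%R] <=
    (expR c / (1 + \sum_(X0 i <= k < n.+1) (F i k)^-1))%:E)%E.
  have E := @expectation_blocks [:: i] (fun=> n) (fun _ y => expR (- 1 * y))
    (fun i k => F i k / (F i k + 1)).
  have {}E : (\int[P]_w (expR (- 1 * psum i n w))%:E =
     (\prod_(X0 i <= k < n.+1) (F i k / (F i k + 1)))%:E)%E.
    move: E; rewrite big_seq1 => <- //.
    - by apply: eq_integral => w _; rewrite big_seq1 prod_expR_psum.
    - by move=> j; rewrite inE => /eqP ->.
    - move=> j; apply: (@measurableT_comp _ _ _ R R R expR setT ( *%R (-1))) => //.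
    - move=> j k; rewrite inE => /eqP -> /andP[ik _].
      have Fk := F_pos iA ik.
      rewrite (exponential_mgf Fk (mtau iA ik) (tau_law iA ik)) ?opprK //.
      by rewrite (lt_trans _ Fk) // ltrN10.
  apply: (@le_trans _ _ (\int[P]_w (expR c * expR (-1 * psum i n w))%:E)%E).
    apply: markov_indicator => //.
    - apply: measurable_funM => //; apply: measurableT_comp => //.
      exact: measurable_funM.
    - by move=> w /= nc; rewrite -expRD -[leLHS]expR0 ler_expR; lra.
  under eq_integral do rewrite EFinM.
  rewrite ge0_integralZl_EFin ?expR_ge0 //; last first.
    by apply/measurable_EFinP; apply: measurableT_comp => //; exact: measurable_funM.
  rewrite E -EFinM lee_fin ler_wpM2l ?expR_ge0 //.
  rewrite (_ : \prod_(X0 i <= k < n.+1) (F i k / (F i k + 1)) =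
    (\prod_(X0 i <= k < n.+1) (1 + (F i k)^-1))^-1); last first.
    rewrite -prodfV; apply: eq_big_nat => k /andP[ik _].
    by have Fk := F_pos iA ik; field; rewrite !gt_eqF // addr_gt0.
  have s0 : 0 <= \sum_(X0 i <= k < n.+1) (F i k)^-1.
    by rewrite big_nat sumr_ge0 // => k /andP[ik _]; rewrite invr_ge0 ltW // F_pos.
  rewrite lef_pV2 ?posrE; last 2 first.
  - rewrite big_nat; apply: prodr_gt0 => k /andP[ik _].
    by rewrite addr_gt0 // invr_gt0 F_pos.
  - by rewrite ltr_wpDr.
  apply: ler_1sum_prod => k; rewrite mem_index_iota => /andP[ik _].
  by rewrite invr_ge0 ltW // F_pos.
exists (\bigcap_(k in [set k | (X0 i <= k)%N]) [set w | psum i k w <= c]); split.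
- exact: bigcap_measurableType.
- apply/eqP; rewrite eq_le measure_ge0 andbT; apply/lee_addgt0Pr => e e0.
  (* With the sum of inverse rates at least [expR c / e], [bound n] is at most [e]. *)
  rewrite add0e; have [n hn] := div (expR c / e).
  have [Xn|nX] := leqP (X0 i) n; last first.
    have := hn; rewrite big_geq // => h0.
    by have : 0 < expR c / e by [rewrite divr_gt0 ?expR_gt0]; rewrite ltNge h0.
  apply: (@le_trans _ _ (P [set w | (psum i n w <= c)%R])).
    apply: le_measure; rewrite ?inE //; first exact: bigcap_measurableType.
    by move=> w; apply.
  apply: (le_trans (bound n)); rewrite lee_fin ler_pdivrMr.
    by rewrite -ler_pdivrMl // mulrC; lra.
  rewrite ltr_wpDr // big_nat sumr_ge0 // => k /andP[ik _].
  by rewrite invr_ge0 ltW // F_pos.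
- by move=> w /= H k /= ik; exact: H.
Qed.

(* Agents outside [s] almost surely do not explode before [c]; [X_1] exceeds [x]
   as soon as [psum 1 x <= c] while the first sojourns of the agents in [s] last
   longer than [c].  The probability of [psum 1 x > c] is estimated jointly with
   the latter event through [expR (lam * (psum 1 x - c))]. *)
Lemma urn_tail_lower (s : seq nat) (c lam : R) (x : nat) :
  (0 < A)%N -> uniq s -> (forall i, i \in s -> (2 <= i <= A)%N) ->
  (forall i, (2 <= i <= A)%N -> i \notin s ->
    forall K, exists n, K <= \sum_(X0 i <= k < n.+1) (F i k)^-1) ->
  0 < c -> 0 < lam -> (forall k, (X0 1 <= k)%N -> lam < F 1 k) ->
  (X0 1 <= x)%N ->
  ((expR (- (c * \sum_(i <- s) F i (X0 i))) *
    (1 - expR (- (lam * c)) * \prod_(X0 1 <= k < x.+1) (F 1 k / (F 1 k - lam))))%:E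
   <= P (escape x))%E.
Proof.
move=> A0 us sA div c0 lam0 lamF Xx.
have sA' i : i \in s -> (1 <= i <= A)%N.
  by move=> /sA /andP[i2 ->]; rewrite ltnW.
have mpsum i k : (1 <= i <= A)%N -> measurable_fun setT (psum i k).
  by move=> iA; exact: (measurable_psum mtau).
have mp1 : measurable_fun setT (psum 1 x) by apply: mpsum; rewrite A0.
pose B := [set w | forall i, i \in s -> c < tau i (X0 i) w].
pose D := [set w | c < psum 1 x w].
have mB : measurable B.
  rewrite (_ : B = \bigcap_(i in [set` s]) [set w | c < tau i (X0 i) w]) //.
  apply: bigcap_measurableType => i /= /sA' iA; apply: measurable_ltr_set => //.
  exact: mtau.
have mD : measurable D by exact: measurable_ltr_set.
(* With blocks ending at [X0 i], only the first sojourn of each agent in [s] enters, and the product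
   of these factors is the indicator of [B]. *)
pose g (i : nat) : R -> R := \1_(`]c, +oo[%classic).
have mg i : measurable_fun setT (g i) by exact: measurable_indic.
have g0 i y : 0 <= g i y by [].
have gB w : \prod_(i <- s) \prod_(X0 i <= k < (X0 i).+1) g i (tau i k w) = \1_B w.
  under eq_bigr do rewrite big_nat1.
  rewrite [RHS]indicE; case: (pselect (B w)) => Bw.
    rewrite mem_set // big_seq big1 // => i is_.
    by rewrite /g indicE mem_set //= in_itv /= andbT Bw.
  rewrite memNset //; have /existsNP [i /not_implyP [is_ ci]] := Bw.
  rewrite (perm_big _ (perm_to_rem is_)) big_cons /g indicE memNset /= ?mul0r //.
  by rewrite in_itv /= andbT.
have Eg i k : i \in s -> (X0 i <= k <= X0 i)%N ->
    (\int[P]_w (g i (tau i k w))%:E = (expR (- (F i k * c)))%:E)%E.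
  move=> is_ /andP[ik _]; have iA := sA' _ is_.
  rewrite -(exponential_tail (mtau iA ik) (tau_law iA ik) c0).
  rewrite -[S in P S]setIT -integral_indic //.
  by rewrite -[S in measurable S]setTI; exact: mtau.
(* At [a = 0] this gives the probability of [B]; at [a = lam] it feeds Markov's inequality for [D]
   on [B]. *)
have Erace a : (forall k, (X0 1 <= k)%N -> a < F 1 k) ->
    (\int[P]_w (expR (a * psum 1 x w) * \1_B w)%:E =
      (\prod_(X0 1 <= k < x.+1) (F 1 k / (F 1 k - a)) *
        expR (- (c * \sum_(i <- s) F i (X0 i))))%:E)%E.
  move=> aF.
  have := expectation_race (n := X0) (r := fun i k => expR (- (F i k * c))) x
    A0 aF us sA mg g0 Eg.
  under eq_integral do rewrite gB.
  move=> ->; congr (_ * _)%:E; under eq_bigr do rewrite big_nat1.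
  rewrite -expR_sum; congr expR; rewrite mulr_sumr -sumrN.
  by apply: eq_bigr => i _; rewrite mulrC.
have PB : P B = (expR (- (c * \sum_(i <- s) F i (X0 i))))%:E.
  have := Erace 0; rewrite big_nat big1 => [|k /andP[Xk _]]; last first.
    by rewrite subr0 divff // gt_eqF // F_pos // A0.
  rewrite mul1r => <-; last by move=> k Xk; rewrite F_pos // A0.
  rewrite -[S in P S]setIT -integral_indic //.
  by apply: eq_integral => w _; rewrite mul0r expR0 mul1r.
have PBD : (P (B `&` D) <= (expR (- (lam * c)) *
    (\prod_(X0 1 <= k < x.+1) (F 1 k / (F 1 k - lam)) *
      expR (- (c * \sum_(i <- s) F i (X0 i)))))%:E)%E.
  rewrite EFinM -Erace // -ge0_integralZl_EFin ?expR_ge0 //.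
  - under eq_integral do rewrite -EFinM.
    apply: markov_indicator; first exact: measurableI.
    + apply: measurable_funM => //; apply: measurable_funM; last first.
        exact: measurable_indic.
      by apply: measurableT_comp => //; exact: measurable_funM.
    + by move=> w; rewrite !mulr_ge0 ?expR_ge0.
    + move=> w [Bw Dw]; rewrite indicE mem_set // mulr1 -expRD.
      by rewrite -[leLHS]expR0 ler_expR; move: Dw; rewrite /D /=; nra.
  - apply/measurable_EFinP; apply: measurable_funM; last exact: measurable_indic.
    by apply: measurableT_comp => //; exact: measurable_funM.
have mE : measurable (escape x).
  by apply: (measurable_urn_lim_gt mtau); rewrite A0.
have PBE : (P B <= P (escape x) + P (B `&` D))%E.
  have mBD : measurable (B `&` D) by exact: measurableI.
  apply: le_trans (measureU2 P mE mBD).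
  apply: (@le_measure_negligible _ _ _ _ _ _ (
    (\bigcup_i [set w | [/\ (2 <= i <= A)%N, i \notin s &
       forall k, (X0 i <= k)%N -> psum i k w <= c]]) `|`
    [set w | ~ forall i k, (1 <= i <= A)%N -> (X0 i <= k)%N -> 0 < tau i k w])) => //.
  - exact: measurableU.
  - apply: negligibleU; last exact: negligible_nonpos_sojourn.
    apply: negligible_bigcup => i.
    have [iA|iA] := boolP (2 <= i <= A)%N; last first.
      by apply: negligibleS (negligible_set0 _) => w /= [].
    have [is_|is_] := boolP (i \in s).
      by apply: negligibleS (negligible_set0 _) => w /= [].
    apply: negligibleS (negligible_no_explosion c _ (div i iA is_)) => [w /= []//|].
    by move: iA => /andP[i2 ->]; rewrite ltnW.
  move=> w Bw.
  have [t0|t0] := pselect (forall i k, (1 <= i <= A)%N -> (X0 i <= k)%N ->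
    0 < tau i k w); last by right; right.
  have [Zw|Zw] := pselect ((\bigcup_i [set w | [/\ (2 <= i <= A)%N, i \notin s &
       forall k, (X0 i <= k)%N -> psum i k w <= c]]) w); first by right; left.
  left; have [Dw|Dw] := pselect (D w); [by right|left].
  have {}Dw : psum 1 x w <= c by rewrite leNgt; apply/negP.
  apply/(urn_lim_gt_psum t0 A0 Xx) => i iA.
  have [is_|is_] := boolP (i \in s).
    exists (X0 i); split=> //; rewrite (le_lt_trans Dw) //.
    by rewrite /Defs.psum big_nat1 Bw.
  (* An agent outside [s] with no partial sum above [psum 1 x] would have all of them at most [c],
     placing [w] in the excluded null set. *)
  apply: contrapT => /forallNP nx; apply: Zw; exists i => //; split=> // k ik.
  rewrite (le_trans _ Dw) // leNgt; apply/negP => xk.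
  by apply: (nx k).
have fE : P (escape x) \is a fin_num by exact: fin_num_measure.
have := le_trans PBE (leeD2l _ PBD).
rewrite PB -(fineK fE) -EFinD !lee_fin; lra.
Qed.
End urn_tail.

(** * Asymptotics *)

Section asymptotics.
Context {R : realType}.
Implicit Types a f g h : nat -> R.

Lemma series_bounded a : (forall k, (1 <= k)%N -> 0 <= a k) ->
  (\sum_(1 <= k <oo) (a k)%:E < +oo)%E ->
  exists B, forall m n, (1 <= m)%N -> \sum_(m <= k < n) a k <= B.
Proof.
move=> a0 afin; have ge0 k : (1 <= k)%N -> xpredT k -> (0 <= (a k)%:E)%E.
  by move=> k1 _; rewrite lee_fin a0.
have fE : (\sum_(1 <= k <oo) (a k)%:E)%E \is a fin_num.
  by rewrite ge0_fin_numE // nneseries_ge0.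
exists (fine (\sum_(1 <= k <oo) (a k)%:E)%E) => m n m1.
rewrite -lee_fin fineK // -sumEFin; apply: le_trans (nneseries_lim_ge n ge0).
rewrite sumEFin sumEFin lee_fin; have [mn|nm] := leqP m n.
  rewrite [leRHS](big_cat_nat m1 mn) lerDr big_nat sumr_ge0 // => k /andP[k1 _].
  exact: a0.
by rewrite big_geq ?(ltnW nm) // big_nat sumr_ge0 // => k /andP[k1 _]; exact: a0.
Qed.

Lemma series_unbounded a : (forall k, (1 <= k)%N -> 0 <= a k) ->
  ~ (\sum_(1 <= k <oo) (a k)%:E < +oo)%E ->
  forall m K, (1 <= m)%N -> exists n, K <= \sum_(m <= k < n.+1) a k.
Proof.
move=> a0 ainf m K m1; apply: contrapT => /forallNP H; apply: ainf.
have ge0 k : (1 <= k)%N -> xpredT k -> (0 <= (a k)%:E)%E.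
  by move=> k1 _; rewrite lee_fin a0.
pose B := \sum_(1 <= k < m) a k + K.
apply: (@le_lt_trans _ _ B%:E); last exact: ltry.
apply: lime_le; first exact: is_cvg_nneseries.
exists m.+1 => // n /= mn; rewrite sumEFin lee_fin /B.
case: n mn => // n; rewrite ltnS => mn.
rewrite (big_cat_nat m1 (leqW mn)) /= lerD2l ltW // ltNge.
by apply/negP; exact: H.
Qed.

(** The finitely many terms before the comparison sets in only contribute a constant. *)
Lemma sum_le_eventually f g m : (\forall k \near \oo, f k <= g k) ->
  exists C, \forall n \near \oo,
    \sum_(m <= k < n.+1) f k <= \sum_(m <= k < n.+1) g k + C.
Proof.
move=> [K _ fg]; pose N := maxn m K.
exists (\sum_(m <= k < N) f k - \sum_(m <= k < N) g k); exists N => // n /= Nn.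
have mN : (m <= N)%N by rewrite leq_maxl.
rewrite !(big_cat_nat mN (leqW Nn)) /=.
have : \sum_(N <= k < n.+1) f k <= \sum_(N <= k < n.+1) g k.
  apply: ler_sum_nat => k /andP[Nk _]; apply: fg => /=.
  by rewrite (leq_trans _ Nk) // leq_maxr.
lra.
Qed.

(** Additive constants vanish relative to [h]. The factors are squared because each bound loses [e]
    twice: in its parameter and in linearizing the logarithm. *)
Lemma asymp_equiv_sandwich f h : h @ \oo --> +oo ->
  (forall e, 0 < e < 1 -> exists C, \forall x \near \oo,
     (1 - e) ^+ 2 * h x - C <= f x <= (1 + e) ^+ 2 * h x + C) ->
  asymp_equiv f h.
Proof.
move=> hoo H; apply/cvgrPdist_lt => eps eps0.
(* The square deviates from 1 by at most [3 * e] and the constant adds less than [e * h x], so the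
   total relative error stays below [4 * e]. *)
pose e := Num.min eps 1 / 4.
have e0 : 0 < e by rewrite divr_gt0 // lt_min eps0 ltr01.
have e1 : e < 1 by rewrite /e ltr_pdivrMr // mul1r gt_min; apply/orP; right; lra.
have ee : 4 * e <= eps by rewrite /e mulrC divfK // ge_min lexx.
have [|C HC] := H e; first by rewrite e0.
near=> x.
have hx : (`|C| + 1) / e < h x by near: x; apply: cvgry_gt.
have {}hx : `|C| + 1 < e * h x by rewrite -ltr_pdivrMl // mulrC.
have hx0 : 0 < h x by rewrite -(pmulr_rgt0 _ e0) (lt_trans _ hx) // ltr_wpDl.
have /andP[lo hi] : (1 - e) ^+ 2 * h x - C <= f x <= (1 + e) ^+ 2 * h x + C.
  by near: x.
have CC : - `|C| <= C <= `|C| by rewrite -ler_norml.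
rewrite (_ : 1 - f x / h x = (h x - f x) / h x); last by field; rewrite gt_eqF.
rewrite normrM normfV (gtr0_norm hx0) ltr_pdivrMr //.
apply: (@lt_le_trans _ _ (4 * e * h x)); last by rewrite ler_wpM2r // ltW.
have e2 : e ^+ 2 * h x <= e * h x.
  by rewrite ler_wpM2r ?(ltW hx0) // expr2 ger_pMr // ltW.
by rewrite ltr_norml; apply/andP; split; nra.
Unshelve. all: by end_near. Qed.

(** Each factor equals [1 + c / (F k - c)]. The sign of [c] is free: the lower bound on the
    logarithm takes it negative. *)
Lemma prod_ratio_le_expR (F : nat -> R) (c : R) m n :
  (forall k, (m <= k)%N -> 0 < F k) -> (forall k, (m <= k)%N -> c < F k) ->
  \prod_(m <= k < n) (F k / (F k - c)) <= expR (\sum_(m <= k < n) c / (F k - c)).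
Proof.
move=> F0 cF; rewrite expR_sum big_nat [leRHS]big_nat; apply: ler_prod => k /andP[mk _].
have Fc : 0 < F k - c by rewrite subr_gt0 cF.
rewrite divr_ge0 ?(ltW Fc) ?(ltW (F0 _ mk)) //=.
rewrite (_ : F k / (F k - c) = 1 + c / (F k - c)); last by field; rewrite gt_eqF.
exact: expR_ge1Dx.
Qed.

(** Provides the parameter [lam] at which all exponential moments of agent 1's sojourns are
    finite. *)
Lemma exists_pos_lower_bound (F : nat -> R) m :
  (forall k, (m <= k)%N -> 0 < F k) -> F @ \oo --> +oo ->
  exists2 l, 0 < l & forall k, (m <= k)%N -> l < F k.
Proof.
move=> F0 /cvgryPgt /(_ 1) [K _ FK].
suff [l l0 hl] : exists2 l, 0 < l & forall k, (m <= k < K)%N -> l < F k.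
  exists (Num.min l 1) => [|k mk]; first by rewrite lt_min l0 ltr01.
  rewrite gt_min; have [Kk|kK] := leqP K k; first by rewrite FK ?orbT.
  by rewrite hl // mk.
elim: K {FK} => [|K [l l0 hl]]; first by exists 1 => // k; rewrite andbF.
have [mK|Km] := leqP m K; last first.
  by exists l => // k /andP[mk kK]; move: (leq_ltn_trans mk kK); rewrite ltnS leqNgt Km.
exists (Num.min l (F K / 2)) => [|k].
  by rewrite lt_min l0 divr_gt0 // F0.
move=> /andP[mk]; rewrite ltnS leq_eqVlt => /predU1P[->|kK].
  by rewrite gt_min; apply/orP; right; have := F0 K mK; lra.
by rewrite gt_min hl // mk.
Qed.
End asymptotics.

(** * Consequences of summable inverse rates *)

Section summable_rates.
Context {R : realType}.
Variable f : nat -> R.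
Hypothesis f_gt0 : forall k, (1 <= k)%N -> 0 < f k.
Hypothesis f_sum : (\sum_(1 <= k <oo) ((f k)^-1)%:E < +oo)%E.

Let inv_ge0 k : (1 <= k)%N -> 0 <= (f k)^-1.
Proof. by move=> k1; rewrite invr_ge0 ltW // f_gt0. Qed.

(* A decreasing rate is bounded, so that its inverses are not summable. *)
Lemma summable_inv_monotone :
  (forall m n, (1 <= m)%N -> (m < n)%N -> f m < f n) \/
  (forall m n, (1 <= m)%N -> (m < n)%N -> f n < f m) ->
  forall m k, (1 <= m <= k)%N -> f m <= f k.
Proof.
have [B HB] := series_bounded inv_ge0 f_sum.
case=> fm m k /andP[m1].
  by rewrite leq_eqVlt => /predU1P[->//|mk]; rewrite ltW // fm.
(* More than [B * f 1] terms, each at least [(f 1)^-1], exceed the bound [B]. *)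
exfalso; pose n := (Num.truncn (B * f 1%N)).+1.
have := HB 1%N n.+1 (leqnn _); apply/negP; rewrite -ltNge.
apply: (@lt_le_trans _ _ (n%:R / f 1%N)).
  by rewrite ltr_pdivlMr ?f_gt0 // truncnS_gt.
rewrite (_ : n%:R / f 1%N = \sum_(1 <= j < n.+1) (f 1%N)^-1); last first.
  by rewrite sumr_const_nat subSS subn0 mulr_natl.
apply: ler_sum_nat => j /andP[j1 _]; rewrite lef_pV2 ?posrE ?f_gt0 //.
by move: j1; rewrite leq_eqVlt => /predU1P[<-//|j1]; rewrite ltW // fm.
Qed.

(** Since [f k >= f m], the denominators are at least [e * f k], so the logarithm of the product is
    controlled by the convergent sum of inverse rates. This gives the constant [C] of
    [urn_tail_upper]. *)
Lemma prod_ratio_bounded (m : nat) (e : R) : (1 <= m)%N ->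
  (forall k, (m <= k)%N -> f m <= f k) -> 0 < e < 1 ->
  exists C, forall n, \prod_(m <= k < n) (f k / (f k - (1 - e) * f m)) <= expR C.
Proof.
move=> m1 fm /andP[e0 e1]; have [B HB] := series_bounded inv_ge0 f_sum.
have fm0 := f_gt0 m1; exists ((1 - e) * f m / e * B) => n.
have ek k : (m <= k)%N -> e * f k <= f k - (1 - e) * f m.
  by move=> /fm fmk; have := f_gt0 m1; nra.
apply: le_trans (prod_ratio_le_expR _ _ _) _ => [k mk|k mk|].
- by rewrite f_gt0 // (leq_trans m1).
- by rewrite -subr_gt0 (lt_le_trans _ (ek _ mk)) // mulr_gt0 // f_gt0 // (leq_trans m1).
rewrite ler_expR; apply: le_trans (ler_wpM2l _ (HB m n m1)); last first.
  by rewrite divr_ge0 ?mulr_ge0 ?subr_ge0 ?ltW.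
rewrite mulr_sumr; apply: ler_sum_nat => k /andP[mk _].
have fk0 : 0 < f k by rewrite f_gt0 // (leq_trans m1).
rewrite -[leRHS]mulrA -invfM ler_wpM2l ?mulr_ge0 ?subr_ge0 ?(ltW e1) ?(ltW fm0) //.
by rewrite lef_pV2 ?posrE ?mulr_gt0 // ?(lt_le_trans _ (ek _ mk)) ?mulr_gt0 // ek.
Qed.
End summable_rates.

(** * From probability bounds to logarithms *)

Section escape_bounds.
Context {R : realType}.
Variables (F : nat -> R) (m : nat) (p : nat -> R) (dM : R).
Hypothesis F_gt0 : forall k, (m <= k)%N -> 0 < F k.
Hypothesis F_oo : F @ \oo --> +oo.
Hypothesis dM_gt0 : 0 < dM.
Local Notation H x := (\sum_(m <= k < x.+1) (F k)^-1).

(** One factor [1 - e] comes from the parameter [th], the other from comparing [th / (F k + th)]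
    with [th / F k], which holds once [F k >= th / e]. *)
Lemma log_tail_lower (e C : R) : 0 < e < 1 ->
  (\forall x \near \oo, 0 < p x) ->
  (\forall x \near \oo, p x <=
    \prod_(m <= k < x.+1) (F k / (F k + (1 - e) * dM)) * expR C) ->
  exists C', \forall x \near \oo, (1 - e) ^+ 2 * (dM * H x) - C' <= - ln (p x).
Proof.
move=> /andP[e0 e1] p0 hp.
pose th := (1 - e) * dM.
have th0 : 0 < th by rewrite mulr_gt0 ?subr_gt0.
have [|C1 hC1] := @sum_le_eventually R
    (fun k => (1 - e) * th * (F k)^-1) (fun k => th / (F k + th)) m.
  near=> k.
  have mk : (m <= k)%N by near: k; exists m.
  have Fk := F_gt0 mk.
  have big : th / e <= F k by near: k; apply: cvgry_ge.
  have {}big : th <= e * F k by rewrite -ler_pdivrMl // mulrC.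
  rewrite ler_pdivrMr // mulrAC ler_pdivlMr ?addr_gt0 //.
  nra.
exists (C1 + C); near=> x.
have px : 0 < p x by near: x.
have hpx : p x <= \prod_(m <= k < x.+1) (F k / (F k + th)) * expR C by near: x.
have hx : \sum_(m <= k < x.+1) (1 - e) * th * (F k)^-1 <=
    \sum_(m <= k < x.+1) th / (F k + th) + C1 by near: x.
have pr : \prod_(m <= k < x.+1) (F k / (F k + th)) <=
    expR (- \sum_(m <= k < x.+1) th / (F k + th)).
  rewrite (eq_bigr (fun k => F k / (F k - - th))); last by move=> k _; rewrite opprK.
  apply: le_trans (prod_ratio_le_expR _ _ _) _ => // [k mk|].
    by rewrite (lt_trans _ (F_gt0 mk)) // oppr_lt0.
  rewrite ler_expR -sumrN; apply: ler_sum => k _; rewrite opprK mulNr lexx //.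
have : ln (p x) <= - \sum_(m <= k < x.+1) th / (F k + th) + C.
  rewrite -[leRHS]expRK ler_ln ?posrE ?expR_gt0 //.
  by apply: (le_trans hpx); rewrite expRD ler_wpM2r ?expR_ge0.
move: hx; rewrite -mulr_sumr.
rewrite (_ : (1 - e) * th * H x = (1 - e) ^+ 2 * (dM * H x)); last by rewrite /th; ring.
lra.
Unshelve. all: by end_near. Qed.

(** Taking [c] slightly above the sum of inverse rates makes the bracket at least one half.
    Positivity of [p x] is recorded because [log_tail_lower] requires it. *)
Lemma log_tail_upper (e lam : R) : 0 < e -> 0 < lam ->
  (forall k, (m <= k)%N -> lam < F k) ->
  (fun x => H x) @ \oo --> +oo ->
  (\forall x \near \oo, forall c, 0 < c ->
    expR (- (c * dM)) * (1 - expR (- (lam * c)) *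
      \prod_(m <= k < x.+1) (F k / (F k - lam))) <= p x) ->
  exists C, \forall x \near \oo,
    0 < p x /\ - ln (p x) <= (1 + e) ^+ 2 * (dM * H x) + C.
Proof.
move=> e0 lam0 lamF Hoo hp.
have [|C1 hC1] := @sum_le_eventually R
    (fun k => lam / (F k - lam)) (fun k => (1 + e) * lam * (F k)^-1) m.
  near=> k.
  have mk : (m <= k)%N by near: k; exists m.
  have Fk := F_gt0 mk.
  (* This threshold is exactly what [lam / (F k - lam) <= (1 + e) * lam / F k] requires. *)
  have big : (1 + e) * lam / e <= F k by near: k; apply: cvgry_ge.
  have {}big : (1 + e) * lam <= e * F k by rewrite -ler_pdivrMl // mulrC.
  rewrite ler_pdivrMr ?subr_gt0 ?lamF // mulrAC ler_pdivlMr //.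
  nra.
exists (ln 2); near=> x.
have hx : \sum_(m <= k < x.+1) lam / (F k - lam) <=
    \sum_(m <= k < x.+1) (1 + e) * lam * (F k)^-1 + C1 by near: x.
have hpx : forall c, 0 < c -> expR (- (c * dM)) * (1 - expR (- (lam * c)) *
      \prod_(m <= k < x.+1) (F k / (F k - lam))) <= p x by near: x.
have H0 : 0 < H x by near: x; apply: cvgry_gt.
(* One factor [1 + e] in [c] pays for the comparison above; the surplus [lam * (1 + e) * e * H x]
   must absorb [C1] and leave an exponent of at most -1, and [expR (- 1)] is at most one half. *)
have big : (1 + C1) / (lam * (1 + e) * e) <= H x by near: x; apply: cvgry_ge.
have {}big : 1 + C1 <= lam * (1 + e) * e * H x.
  by rewrite -ler_pdivrMl 1?mulrC // !mulr_gt0 // addr_gt0.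
pose c := (1 + e) ^+ 2 * H x.
have c0 : 0 < c by rewrite mulr_gt0 // exprn_gt0 // addr_gt0.
have half : expR (- (lam * c)) * \prod_(m <= k < x.+1) (F k / (F k - lam)) <= 1 / 2.
  have pr := prod_ratio_le_expR x.+1 F_gt0 lamF.
  apply: (@le_trans _ _ (expR (- 1))).
    apply: le_trans (ler_wpM2l (expR_ge0 _) pr) _.
    rewrite -expRD ler_expR.
    move: hx; rewrite -[X in _ <= X + _]mulr_sumr /c => hx.
    have -> : lam * ((1 + e) ^+ 2 * H x) =
      lam * (1 + e) * e * H x + (1 + e) * lam * H x by ring.
    lra.
  rewrite expRN div1r lef_pV2 ?posrE ?expR_gt0 //.
  by have := expR_ge1Dx (1 : R).
have lo : expR (- (c * dM) - ln 2) <= p x.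
  apply: le_trans (hpx c c0).
  rewrite expRD (expRN (ln 2)) lnK ?posrE // ler_wpM2l ?expR_ge0 //.
  lra.
have px : 0 < p x by apply: lt_le_trans lo; exact: expR_gt0.
split => //; rewrite lerNl -[leLHS]expRK ler_ln ?posrE ?expR_gt0 //.
by apply: le_trans lo; rewrite ler_expR /c; lra.
Unshelve. all: by end_near. Qed.
End escape_bounds.

Theorem theorem4 (R : realType) (d : measure_display) (T : measurableType d)
  (P : probability T R) (A : nat) (F : nat -> nat -> R) (X0 : nat -> nat)
  (tau : nat -> nat -> T -> R) :
  (2 <= A)%N ->
  (forall i k, (1 <= i <= A)%N -> (1 <= k)%N -> 0 < F i k) ->
  (forall i, (1 <= i <= A)%N -> (1 <= X0 i)%N) ->
  (* sojourn times: measurable, exponential with rate F_i(k), independent *)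
  (forall i k, (1 <= i <= A)%N -> (X0 i <= k)%N -> measurable_fun setT (tau i k)) ->
  (forall i k, (1 <= i <= A)%N -> (X0 i <= k)%N ->
     forall B : set R, measurable B ->
       P (tau i k @^-1` B) = exponential_prob (F i k) B) ->
  mutually_independent P
    [set ik : nat * nat | (1 <= ik.1 <= A)%N /\ (X0 ik.1 <= ik.2)%N]
    (fun ik => tau ik.1 ik.2) ->
  let inM := fun i : nat =>
    (1 <= i <= A)%N /\ (\sum_(1 <= k <oo) ((F i k)^-1)%:E < +oo)%E in
  (exists i, inM i) ->
  ~ inM 1%N ->
  F 1%N @ \oo --> +oo ->
  (forall i, inM i ->
     (forall m n, (1 <= m)%N -> (m < n)%N -> F i m < F i n) \/
     (forall m n, (1 <= m)%N -> (m < n)%N -> F i n < F i m)) ->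
  let dM := \sum_(1 <= i < A.+1 | `[< inM i >]) F i (X0 i) in
  asymp_equiv
    (fun x : nat => - ln (fine (P [set w | ((x%:R)%:E < urn_lim A X0 tau 1 w)%E])))
    (fun x : nat => dM * \sum_(X0 1%N <= k < x.+1) (F 1%N k)^-1).
Proof.
move=> A2 F_gt0 X0_ge1 mtau law indep inM [i0 i0M] n1M F1oo mono dM.
have A0 : (0 < A)%N by rewrite ltnW.
have X1 : (1 <= X0 1)%N by rewrite X0_ge1 ?A0.
have F1_gt0 k : (X0 1%N <= k)%N -> 0 < F 1%N k.
  by move=> Xk; rewrite F_gt0 ?A0 // (leq_trans X1).
have Finv i : (1 <= i <= A)%N -> forall k, (1 <= k)%N -> 0 <= (F i k)^-1.
  by move=> iA k k1; rewrite invr_ge0 ltW // F_gt0.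
pose s := [seq i <- index_iota 1 A.+1 | `[< inM i >]].
have us : uniq s by rewrite filter_uniq // iota_uniq.
have sM i : i \in s -> inM i by rewrite mem_filter => /andP[/asboolP].
have Ms i : inM i -> i \in s.
  move=> iM; rewrite mem_filter; apply/andP; split; first exact/asboolP.
  by rewrite mem_index_iota ltnS; case: iM.
have sA i : i \in s -> (2 <= i <= A)%N.
  move=> /sM iM; have [/andP[i1 ->] _] := iM; rewrite andbT.
  by move: i1 iM; rewrite leq_eqVlt => /predU1P[<- /n1M|].
have dME : dM = \sum_(i <- s) F i (X0 i) by rewrite /dM /s big_filter.
have s_gt0 i : i \in s -> 0 < F i (X0 i).
  by move=> /sM [iA _]; rewrite F_gt0 // X0_ge1.
have dM_gt0 : 0 < dM.
  rewrite dME (perm_big _ (perm_to_rem (Ms _ i0M))) big_cons ltr_wpDr ?s_gt0 ?Ms //.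
  by rewrite big_seq sumr_ge0 // => i /mem_rem /s_gt0 /ltW.
have s_min i k : i \in s -> (X0 i <= k)%N -> F i (X0 i) <= F i k.
  move=> /sM iM ik; have [iA isum] := iM.
  apply: (summable_inv_monotone _ isum (mono i iM)); last by rewrite X0_ge1.
  by move=> j; exact: F_gt0.
(* As agent 1 is not in [M], its inverse rates are not summable, from whatever state the sum
   starts. *)
pose H x : R := \sum_(X0 1%N <= k < x.+1) (F 1%N k)^-1.
have Hoo : H @ \oo --> +oo.
  apply/cvgryPge => K.
  have A1 : (1 <= 1 <= A)%N by rewrite A0.
  have F1div : ~ (\sum_(1 <= k <oo) ((F 1%N k)^-1)%:E < +oo)%E.
    by move=> F1sum; apply: n1M; split.
  have [n Kn] := series_unbounded (Finv 1%N A1) F1div K X1.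
  exists n => // x /= nx; apply: (le_trans Kn); rewrite /H.
  have [Xn|nX] := leqP (X0 1%N) n.+1; last first.
    rewrite [leLHS]big_geq; last exact: ltnW.
    by rewrite big_nat sumr_ge0 // => k /andP[/F1_gt0 ? _]; rewrite invr_ge0 ltW.
  rewrite [leRHS](big_cat_nat Xn) //= lerDl big_nat sumr_ge0 // => k /andP[nk _].
  by rewrite invr_ge0 ltW // F1_gt0 // (leq_trans Xn).
pose p x := fine (P [set w | ((x%:R)%:E < urn_lim A X0 tau 1 w)%E]).
have pE x : P [set w | ((x%:R)%:E < urn_lim A X0 tau 1 w)%E] = (p x)%:E.
  rewrite fineK // fin_num_measure //; apply: (measurable_urn_lim_gt mtau).
  by rewrite A0.
have div i : (2 <= i <= A)%N -> i \notin s ->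
    forall K, exists n, K <= \sum_(X0 i <= k < n.+1) (F i k)^-1.
  move=> /andP[i2 iA] is_ K; have iA' : (1 <= i <= A)%N by rewrite ltnW.
  apply: series_unbounded; [exact: Finv| |exact: X0_ge1].
  by move=> isum; apply: (negP is_); apply: Ms; split.
have [lam lam0 lamF] := exists_pos_lower_bound F1_gt0 F1oo.
apply: asymp_equiv_sandwich.
  apply/cvgryPge => K; near=> x; rewrite -ler_pdivrMl //.
  by near: x; exact: (cvgryPge _).1.
move=> e /andP[e0 e1].
(* This bound comes first because it also yields the eventual positivity of [p]. *)
have [|C1 hC1] := log_tail_upper F1_gt0 F1oo e0 lam0 lamF Hoo (p := p) (dM := dM).
  exists (X0 1%N) => // x /= Xx c c0; rewrite dME -lee_fin -pE.
  exact: (urn_tail_lower F_gt0 X0_ge1 mtau law indep A0 us sA div c0 lam0 lamF Xx).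
have /choice [C hC] : forall i, exists C, i \in s -> forall n,
    \prod_(X0 i <= k < n) (F i k / (F i k - (1 - e) * F i (X0 i))) <= expR C.
  move=> i; have [is_|_] := boolP (i \in s); last by exists 0.
  have [iA isum] := sM _ is_.
  have [|C hC] := prod_ratio_bounded (F_gt0 i ^~ iA) isum (X0_ge1 _ iA)
    (s_min i ^~ is_) (e := e); first by rewrite e0.
  by exists C.
have [|||C2 hC2] := @log_tail_lower _ _ _ p dM F1_gt0 F1oo dM_gt0 e (\sum_(i <- s) C i).
- by rewrite e0.
- by near=> x; have [] : 0 < p x /\ - ln (p x) <= (1 + e) ^+ 2 * (dM * H x) + C1
    by near: x.
(* Each [theta i] is [(1 - e) * F i (X0 i)], so they add up to [(1 - e) * dM]; monotonicity of the
   rates keeps [theta i] below every [F i k]. *)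
- exists (X0 1%N) => // x /= Xx; rewrite -lee_fin -pE dME mulr_sumr.
  apply: (urn_tail_upper F_gt0 X0_ge1 mtau law indep A0 us sA _ _ _ Xx).
  + by move=> i /s_gt0 ?; rewrite mulr_ge0 ?subr_ge0 // ltW.
  + move=> i k is_ ik; apply: lt_le_trans (s_min i k is_ ik).
    by rewrite gtr_pMl ?s_gt0 // gtrBl.
  + move=> N; rewrite expR_sum big_seq [leRHS]big_seq; apply: ler_prod => i is_.
    rewrite hC // andbT big_nat prodr_ge0 // => k /andP[ik _].
    have Fk : (1 - e) * F i (X0 i) < F i k.
      by apply: lt_le_trans (s_min i k is_ ik); rewrite gtr_pMl ?s_gt0 // gtrBl.
    have F0 : 0 < F i k by exact: lt_le_trans (s_gt0 _ is_) (s_min i k is_ ik).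
    by rewrite divr_ge0 ?subr_ge0 // ltW.
exists (Num.max C1 C2); near=> x.
have [_ hi] : 0 < p x /\ - ln (p x) <= (1 + e) ^+ 2 * (dM * H x) + C1 by near: x.
have lo : (1 - e) ^+ 2 * (dM * H x) - C2 <= - ln (p x) by near: x.
have m1 : C1 <= Num.max C1 C2 by rewrite le_max lexx.
have m2 : C2 <= Num.max C1 C2 by rewrite le_max lexx orbT.
rewrite -/(p x) -/(H x); apply/andP; split; lra.
Unshelve. all: by end_near. Qed.
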